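(* Let $m \ge 2$, let $\Bbbk$ be a field, and consider the set $$\mathcal M = \{x_i : 0 \le i \le m-1\} \cup \{y^{b_{ij}} : 1 \le i,j \le m-1\}$$ of formal symbols, where $x_0 = y$. Fix a face $F$ of the Kunz cone $C_m$. There is a sequence of matrices, whose entries are $\Bbbk$-linear combinations of formal products of elements of $\mathcal M$, with the following property: for each numerical semigroup $S$ of multiplicity $m$ in the relative interior of $F$, with semigroup algebra $R$, substituting the variables of $R$ and the values $b_{ij}$ for $S$ into the entries of each matrix yields the boundary maps of a graded minimal free resolution of $\Bbbk$ over $R$.
   Context: A numerical semigroup is a cofinite additively closed set $S \subseteq \mathbb Z_{\ge 0}$ containing $0$; its multiplicity is $m = \min(S\setminus\{0\})$. Its Apéry set is $\operatorname{Ap}(S) = \{n \in S : n - m \notin S\} = \{0, a_1, \ldots, a_{m-1}\}$ with $a_i \equiv i \bmod m$. Set $a_0 = m$. Indices are read modulo $m$, and $b_{ij} = \frac1m(a_i + a_j - a_{i+j}) \in \mathbb Z_{\ge 0}$ (these are the values $b_{ij}$ for $S$). Let $\Bbbk[y,x_1,\ldots,x_{m-1}]$ be graded by $S$ with $\deg y = m$, $\deg x_i = a_i$, and $x_0 = y$. Let $I_S$ be the kernel of the ring homomorphism $\Bbbk[y,x_1,\ldots,x_{m-1}] \to \Bbbk[t]$, $x_i \mapsto t^{a_i}$, and $R = \Bbbk[y,x_1,\ldots,x_{m-1}]/I_S \cong \Bbbk[S]$. The field $\Bbbk$ is an $R$-module as the quotient of $R$ by the ideal generated by $y,x_1,\ldots,x_{m-1}$.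 A graded free resolution is minimal if the matrices of its maps contain no nonzero constant entries. The Kunz cone $C_m \subseteq \mathbb R_{\ge 0}^{m-1}$ is the polyhedral cone defined by the inequalities $z_i + z_j \ge z_{i+j}$ for all $i,j \in \{1,\ldots,m-1\}$ with $i+j \not\equiv 0 \bmod m$ (subscripts modulo $m$). A numerical semigroup $S$ of multiplicity $m$ is said to lie in the relative interior of a face $F$ of $C_m$ if the point $(a_1,\ldots,a_{m-1})$ lies in the relative interior of $F$. *)

(* Defs.v *)
From HB Require Import structures.
From mathcomp Require Import all_boot all_order all_algebra.
From mathcomp Require Import mpoly.
From mathcomp Require Import boolp classical_sets cardinality reals.

Set Implicit Arguments.
Unset Strict Implicit.
Unset Printing Implicit Defensive.

Import Order.TTheory GRing.Theory Num.Theory.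

Local Open Scope classical_set_scope.
Local Open Scope quotient_scope.
Local Open Scope ring_scope.

Section NumericalSemigroup.
Local Open Scope nat_scope.

Definition numerical_semigroup (S : set nat) : Prop :=
  [/\ S 0, (forall p q, S p -> S q -> S (p + q)) & finite_set (~` S)].

Definition multiplicity (S : set nat) (m : nat) : Prop :=
  [/\ S m, 0 < m & forall n, S n -> 0 < n -> m <= n].

(* The guard m <= n makes n - m an integer subtraction. *)
Definition apery_set (S : set nat) (m : nat) : set nat :=
  [set n | S n /\ ~ (m <= n /\ S (n - m))].

(* a_i, the index i being read modulo m; a_0 is m, not the element 0 of the
   Apery set.  The default value of xget is never used, see apery_eltP. *)
Definition apery_elt (S : set nat) (m i : nat) : nat :=
  if m %| i then m else xget 0 [set n | apery_set S m n /\ n = i %[mod m]].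

Lemma apery_eltP (S : set nat) (m i : nat) :
    numerical_semigroup S -> multiplicity S m -> ~~ (m %| i) ->
  apery_set S m (apery_elt S m i) /\ apery_elt S m i = i %[mod m].
Proof.
move=> [_ _ /finite_seqP [X SX]] [_ m_gt0 _] /negPf mi.
rewrite /apery_elt mi.
suff [n Pn] : exists n, apery_set S m n /\ n = i %[mod m].
  by have /= := @xgetI _ 0 [set n | apery_set S m n /\ n = i %[mod m]] n Pn.
have ex : exists n, `[< S n >] && (n %% m == i %% m).
  pose M := \sum_(x <- X) x.
  exists (M.+1 * m + i); rewrite modnMDl eqxx andbT; apply/asboolP.
  apply: contrapT => nS.
  have : (~` S) (M.+1 * m + i) by [].
  rewrite SX /= => inX.
  have : M.+1 * m + i <= M.
    by rewrite {2}/M (big_rem _ inX) /= leq_addr.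
  apply/negP; rewrite -ltnNge; apply: (@leq_trans (M.+1 * m)).
    by rewrite leq_pmulr.
  exact: leq_addr.
have := ex_minnP ex.
case=> n /andP [/asboolP Sn /eqP ni] nmin; exists n; split=> //; split=> //.
case=> mn Snm; have := nmin (n - m).
rewrite leqNgt ltn_subrL m_gt0 (leq_trans m_gt0 mn) /=.
suff -> : `[< S (n - m) >] && ((n - m) %% m == i %% m) by move/(_ isT).
apply/andP; split; first exact/asboolP.
by rewrite -ni -{2}(subnK mn) modnDr.
Qed.

(* a_i + a_j - a_(i+j) is a nonnegative multiple of m when S is a numerical
   semigroup of multiplicity m, so nothing is truncated or rounded here. *)
Definition kunz_b (S : set nat) (m i j : nat) : nat :=
  (apery_elt S m i + apery_elt S m j - apery_elt S m (i + j)) %/ m.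

End NumericalSemigroup.

Section Convexity.
Variables (R : realType) (n : nat).
Implicit Types (A C F : set 'rV[R]_n).

Definition affine_hull A : set 'rV[R]_n :=
  [set y | exists (l : nat) (c : 'I_l -> R) (p : 'I_l -> 'rV[R]_n),
    [/\ forall i, A (p i), \sum_i c i = 1 & y = \sum_i c i *: p i]].

Definition relative_interior A : set 'rV[R]_n :=
  [set x | A x /\ exists2 e : R, 0 < e &
    forall y, affine_hull A y -> (forall i, `|y 0 i - x 0 i| < e) -> A y].

(* The set cut out of C by a valid linear inequality w . z >= c; w = 0 gives
   C itself and, for c < 0, the empty face. *)
Definition is_face C F : Prop :=
  exists (w : 'rV[R]_n) (c : R),
    (forall z, C z -> c <= \sum_i w 0 i * z 0 i) /\
    F = [set z | C z /\ \sum_i w 0 i * z 0 i = c].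

End Convexity.

Section KunzCone.
Variables (R : realType) (m : nat).

(* The coordinate z_i, 1 <= i <= m - 1, is the entry of index i - 1; l stands
   for i + j modulo m and exists exactly when i + j is nonzero modulo m. *)
Definition kunz_cone : set 'rV[R]_m.-1 :=
  [set z | (forall i, 0 <= z 0 i) /\
    forall i j l : 'I_m.-1, (l.+1 = i.+1 + j.+1 %[mod m])%N ->
      z 0 l <= z 0 i + z 0 j].

Definition kunz_point (S : set nat) : 'rV[R]_m.-1 :=
  \row_(i < m.-1) (apery_elt S m i.+1)%:R.

End KunzCone.
Arguments kunz_cone R m : clear implicits.
Arguments kunz_point R m S : clear implicits.

Section QuotientModule.
Variables (A : comNzRingType) (l : nat) (g : 'I_l -> A).

Definition gen_ideal : {pred A} :=
  [pred r | `[< exists c : 'I_l -> A, r = \sum_i c i * g i >]].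

Lemma gen_idealP r :
  reflect (exists c : 'I_l -> A, r = \sum_i c i * g i) (r \in gen_ideal).
Proof. exact: asboolP. Qed.

Lemma gen_ideal_zmod_closed : zmod_closed gen_ideal.
Proof.
split=> [|r s /gen_idealP[c ->] /gen_idealP[d ->]]; apply/gen_idealP.
  by exists (fun=> 0); rewrite big1 // => i _; rewrite mul0r.
exists (fun i => c i - d i); rewrite -sumrB.
by apply: eq_bigr => i _; rewrite mulrBl.
Qed.

HB.instance Definition _ :=
  GRing.isZmodClosed.Build A gen_ideal gen_ideal_zmod_closed.

Lemma gen_idealMr a r : r \in gen_ideal -> a * r \in gen_ideal.
Proof.
move=> /gen_idealP[c ->]; apply/gen_idealP; exists (fun i => a * c i).
by rewrite mulr_sumr; apply: eq_bigr => i _; rewrite mulrA.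
Qed.

(* The quotient A / (g_0, ..., g_(l-1)) as an A-module. *)
Definition quot_module : Type := {ideal_quot gen_ideal}.
HB.instance Definition _ := EqQuotient.on quot_module.
HB.instance Definition _ := GRing.Zmodule.on quot_module.

Definition quot_pi (r : A) : quot_module := \pi_({ideal_quot gen_ideal}) r.

Definition quot_scale (a : A) (q : quot_module) : quot_module :=
  quot_pi (a * repr q).

Lemma quot_piP r s : quot_pi r = quot_pi s <-> r - s \in gen_ideal.
Proof. by rewrite Quotient.idealrBE; split => [/eqP|/eqP]. Qed.

Lemma quot_piD r s : quot_pi (r + s) = quot_pi r + quot_pi s.
Proof. exact: (raddfD (\pi_({ideal_quot gen_ideal}))). Qed.

Lemma quot_reprK q : quot_pi (repr q) = q.
Proof. exact: reprK. Qed.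

Lemma quot_scale_pi a r : quot_scale a (quot_pi r) = quot_pi (a * r).
Proof.
apply/quot_piP; rewrite -mulrBr; apply: gen_idealMr.
by apply/quot_piP; rewrite quot_reprK.
Qed.

Lemma quot_scaleA a b q : quot_scale a (quot_scale b q) = quot_scale (a * b) q.
Proof. by rewrite -[q]quot_reprK !quot_scale_pi mulrA. Qed.

Lemma quot_scale1 : left_id 1 quot_scale.
Proof. by move=> q; rewrite -[q]quot_reprK quot_scale_pi mul1r. Qed.

Lemma quot_scaleDr : right_distributive quot_scale +%R.
Proof.
move=> a p q; rewrite -[p]quot_reprK -[q]quot_reprK -quot_piD.
by rewrite !quot_scale_pi mulrDr quot_piD.
Qed.

Lemma quot_scaleDl q : {morph quot_scale^~ q : a b / a + b}.
Proof.
by move=> a b; rewrite /= -[q]quot_reprK !quot_scale_pi mulrDl quot_piD.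
Qed.

HB.instance Definition _ := GRing.Zmodule_isLmodule.Build A quot_module
  quot_scaleA quot_scale1 quot_scaleDr quot_scaleDl.

End QuotientModule.

Section Resolution.
Variables (A : comNzRingType) (M : lmodType A).
(* homA z a: a is homogeneous of degree z; likewise homM. *)
Variables (homA : int -> A -> Prop) (homM : int -> M -> Prop).
Variables (r : nat -> nat) (d : forall n, 'M[A]_(r n, r n.+1)).

(* Matrices act on column vectors, d n : A^(r (n+1)) -> A^(r n); the basis
   vector i of A^(r n) has degree e n i.  A homogeneous map of degree 0 sends
   each basis vector to an element of the same degree. *)
Definition graded_free_resolution : Prop :=
  exists (eps : {linear 'cV[A]_(r 0) -> M}) (e : forall n, 'I_(r n) -> int),
    [/\ forall q, exists v, eps v = q,
        forall v, eps v = 0 <-> exists u, v = d 0 *m u,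
        forall n (v : 'cV[A]_(r n.+1)), d n *m v = 0 <-> exists u, v = d n.+1 *m u,
        forall i, homM (e 0%N i) (eps (delta_mx i 0)) &
        forall n i j, homA (e n.+1 j - e n i) (d n i j)].

End Resolution.

Section SemigroupAlgebra.
Variables (K : fieldType) (m : nat) (S : set nat).

Local Notation a := (apery_elt S m).

(* The variable 'X_i is x_i, and x_0 is y. *)
Definition toric_map : {mpoly K[m]} -> {poly K} :=
  mmap polyC (fun i : 'I_m => 'X^(a i)).

HB.instance Definition _ := GRing.RMorphism.copy toric_map
  (mmap polyC (fun i : 'I_m => 'X^(a i))).

Definition toric_ideal : {pred {mpoly K[m]}} := [pred p | toric_map p == 0].

Lemma toric_ideal_idealr : idealr_closed toric_ideal.
Proof.
split=> [||p u v]; rewrite !inE ?rmorph0 ?rmorph1 ?oner_eq0 //.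
by move=> /eqP u0 /eqP v0; rewrite rmorphD rmorphM /= u0 v0 mulr0 addr0.
Qed.

HB.instance Definition _ :=
  isIdealr.Build {mpoly K[m]} toric_ideal toric_ideal_idealr.

Definition semigroup_algebra : Type := {ideal_quot toric_ideal}.
HB.instance Definition _ := GRing.ComNzRing.on semigroup_algebra.

Definition alg_pi : {mpoly K[m]} -> semigroup_algebra :=
  \pi_({ideal_quot toric_ideal}).
HB.instance Definition _ := GRing.RMorphism.copy alg_pi
  \pi_({ideal_quot toric_ideal}).

Definition alg_var (i : 'I_m) : semigroup_algebra := alg_pi 'X_i.
Definition alg_const (c : K) : semigroup_algebra := alg_pi c%:MP.
HB.instance Definition _ := GRing.RMorphism.copy alg_const
  (alg_pi \o @mpolyC m K).

Definition alg_homog (z : int) (f : semigroup_algebra) : Prop :=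
  exists2 p : {mpoly K[m]}, f = alg_pi p &
    forall mu, mu \in msupp p -> (\sum_(i < m) mu i * a i)%N%:Z = z.

(* The quotient by the ideal (y, x_1, ..., x_(m-1)); this is a copy of K. *)
Definition residue_field : Type := quot_module alg_var.
HB.instance Definition _ := GRing.Lmodule.on residue_field.

Definition residue_homog (z : int) (q : residue_field) : Prop :=
  exists2 f, q = quot_pi alg_var f & alg_homog z f.

Definition minimal_graded_resolution_of_residue_field
    (r : nat -> nat) (d : forall n, 'M[semigroup_algebra]_(r n, r n.+1)) :=
  graded_free_resolution alg_homog residue_homog d /\
  forall n i j (c : K), c != 0 -> d n i j <> alg_const c.

End SemigroupAlgebra.

Section FormalSymbols.
Variables (K : fieldType) (m : nat).

(* inl i is the symbol x_i, and inr (i, j) the symbol y^(b_(i+1, j+1)). *)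
Definition kunz_symbol : finType := ('I_m + 'I_m.-1 * 'I_m.-1)%type.

(* The K-linear combinations of formal products of symbols. *)
Definition formal_poly : Type := {mpoly K[#|kunz_symbol|]}.
HB.instance Definition _ := GRing.ComNzRing.on formal_poly.

Variables (m_gt1 : (1 < m)%N) (S : set nat).

Definition symbol_value (s : kunz_symbol) : semigroup_algebra K m S :=
  match s with
  | inl i => alg_var K S i
  | inr (i, j) =>
      alg_var K S (Ordinal (ltnW m_gt1)) ^+ kunz_b S m i.+1 j.+1
  end.

Definition formal_subst : formal_poly -> semigroup_algebra K m S :=
  mmap (@alg_const K m S) (fun i => symbol_value (enum_val i)).
HB.instance Definition _ := GRing.RMorphism.copy formal_subst
  (mmap (@alg_const K m S) (fun i => symbol_value (enum_val i))).

End FormalSymbols.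

(* Main.v *)
From HB Require Import structures.
Require Import Defs.
From mathcomp Require Import all_boot all_order all_algebra.
From mathcomp Require Import mpoly.
From mathcomp Require Import boolp classical_sets reals.
From mathcomp Require Import perm zify lra.

(** Put [k[y]] for the polynomial ring in [y = x_0], called the base ring below.
    For every semigroup the algebra [R] is a free [k[y]]-module with basis
    [1, x_1, ..., x_(m-1)].  The product of the basis elements of indices [i]
    and [j] is a power of [y] times the one of index [i + j]; for nonzero [i] and
    [j] the exponent is [b_ij], or [b_ij + 1] if [i + j] is zero modulo [m].  A
    graded [R]-module with a finite homogeneous [k[y]]-basis is given by matrices
    over [k[y]], one for the action of each basis element of [R].  A formal
    matrix in the symbols [y] and [y^(b_ij)] describes such matrices for all
    semigroups at once.

    The resolution is built from its modules of syzygies.  The first one is the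
    maximal ideal, free over [k[y]] with basis [y, x_1, ..., x_(m-1)].  Let [N]
    be a syzygy module with its [k[y]]-basis and its action matrices.  Some
    elements of this basis form a minimal system of generators of [N], and
    which ones do so is decided by the reduction of [N] modulo [y].  They define
    a surjection from a free [R]-module [G] to [N].  Both are free over
    [k[y]], and the matrix [Pi] of the surjection has as many columns as [N] has
    basis elements.  By Nakayama's lemma [Pi] has full rank modulo [y], so a
    square block of [Pi] is invertible modulo [y].  The determinant of the block
    is homogeneous for the grading, that is, a constant times a power of [y]; it
    is nonzero modulo [y], so it is a nonzero constant, and the adjugate matrix
    of the block gives a formal inverse.  Eliminating with this block produces a
    [k[y]]-basis of the kernel of the surjection, again with formal entries, and
    the kernel is the next syzygy module.  See [pres_full], [split_pres] and
    [next_syz].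

    All choices made above depend only on the formal matrices after [y] has been
    set to 0, that is, after each symbol [y^(b_ij)] has been replaced by 1 or 0
    according to whether [b_ij] vanishes.  If [i + j] is zero modulo [m] then
    [b_ij] is positive.  Otherwise the vanishing of [b_ij] says that the Kunz
    point satisfies one of the defining inequalities of the cone with equality,
    and all points in the relative interior of a face satisfy the same
    ones with equality ([relint_tight], [kunz_b_face]).  Hence one run of the
    construction serves all semigroups of the face.  Minimality holds because
    the generators chosen at each step are independent modulo the maximal
    ideal. *)

Set Implicit Arguments.
Unset Strict Implicit.
Unset Printing Implicit Defensive.

Import Order.TTheory GRing.Theory Num.Theory.

Local Open Scope ring_scope.

(** * Selecting rows of matrices over a field *)

Section ChoosingRows.
Variable K : fieldType.

Lemma rowsub_unit_exists (p r : nat) (A : 'M[K]_(p, r)) :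
  row_full A -> exists f : 'I_r -> 'I_p, injective f /\ rowsub f A \in unitmx.
Proof.
move=> fA; exists (fullrankfun fA); split; first exact: fullrankfun_inj.
exact: fullrowsub_unit.
Qed.

(** The rows of the cokernel matrix of [W] are the images of the standard basis
    in the quotient by the row space of [W], and a maximal independent set of
    rows is a basis of that quotient.  Choosing standard basis vectors instead
    of combinations of them keeps the generators homogeneous for every grading
    that gives the standard basis vectors degrees. *)
Lemma minimal_generators (r p : nat) (W : 'M[K]_(p, r)) :
  exists (q : nat) (g : 'I_q -> 'I_r),
    (1%:M <= rowsub g 1%:M + W)%MS /\
    forall u : 'rV_q, (u *m rowsub g 1%:M <= W)%MS -> u = 0.
Proof.
pose Q := cokermx W; exists (\rank Q), (maxrankfun Q); split.
  have /submxP[T QT] : (Q <= rowsub (maxrankfun Q) Q)%MS.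
    by rewrite eq_maxrowsub.
  set g := maxrankfun Q in QT *.
  have sub_W : (1%:M - T *m rowsub g 1%:M <= W)%MS.
    rewrite submxE -/Q mulmxBl mul1mx -mulmxA mul_rowsub_mx mul1mx.
    by rewrite -QT subrr.
  rewrite -[X in (X <= _)%MS](subrK (T *m rowsub g 1%:M)) addrC.
  by rewrite addmx_sub_adds ?submxMl.
move=> u; rewrite submxE -/Q -mulmxA mul_rowsub_mx mul1mx => /eqP u0.
by apply: (row_free_inj (maxrowsub_free Q)); rewrite u0 mul0mx.
Qed.

End ChoosingRows.

Section Complement.
Variables (r p : nat) (f : 'I_r -> 'I_p).

Definition codom_size := #|[predC codom f]|.
Definition codom_compl (l : 'I_codom_size) : 'I_p := enum_val l.

Hypothesis f_inj : injective f.

Lemma codom_compl_inj : injective codom_compl.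
Proof. exact: enum_val_inj. Qed.

Lemma codom_compl_neq k l : f k != codom_compl l.
Proof.
apply: contraTneq (enum_valP l) => e; rewrite -/(codom_compl l) -e.
by rewrite !inE /= codom_f.
Qed.

Lemma codom_complP s : (exists k, s = f k) \/ (exists l, s = codom_compl l).
Proof.
have [/codomP|sN] := boolP (s \in codom f); first by left.
have sC : s \in [predC codom f] by rewrite !inE.
by right; exists (enum_rank_in sC s); rewrite /codom_compl enum_rankK_in.
Qed.

Variable A : comNzRingType.

Local Notation h := codom_compl.

Lemma compl_mul_tr : rowsub h 1%:M *m (rowsub h 1%:M)^T = 1%:M :> 'M[A]__.
Proof.
rewrite trmx_mxsub trmx1; apply/matrixP=> k l.
by rewrite mul_rowsub_mx mul1mx !mxE (inj_eq codom_compl_inj).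
Qed.

Lemma rowsub1_mul_compl_tr :
  rowsub f 1%:M *m (rowsub h 1%:M)^T = 0 :> 'M[A]_(_, _).
Proof.
rewrite trmx_mxsub trmx1; apply/matrixP=> k l.
by rewrite mul_rowsub_mx mul1mx !mxE (negbTE (codom_compl_neq k l)).
Qed.

Lemma rowsub1_partition :
  (rowsub f 1%:M)^T *m rowsub f 1%:M + (rowsub h 1%:M)^T *m rowsub h 1%:M
    = 1%:M :> 'M[A]_p.
Proof.
apply/matrixP=> s t.
have E (q : nat) (g : 'I_q -> 'I_p) :
    ((rowsub g 1%:M)^T *m rowsub g 1%:M : 'M[A]_p) s t
    = \sum_k (s == g k)%:R * (g k == t)%:R.
  by rewrite mxE; apply: eq_bigr => k _; rewrite !mxE eq_sym.
rewrite mxE !E [RHS]mxE.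
have [[k ->]|[l ->]] := codom_complP s.
  rewrite (bigD1 k) //= eqxx mul1r big1 => [|k' /negPf kk]; last first.
    by rewrite (inj_eq f_inj) eq_sym kk mul0r.
  by rewrite big1 ?addr0 // => l _; rewrite (negPf (codom_compl_neq _ _)) mul0r.
rewrite big1 ?add0r => [|k _]; last first.
  by rewrite eq_sym (negPf (codom_compl_neq _ _)) mul0r.
rewrite (bigD1 l) //= eqxx mul1r big1 ?addr0 // => k' /negPf kk.
by rewrite (inj_eq codom_compl_inj) eq_sym kk mul0r.
Qed.

End Complement.

(** * Homogeneous matrices over the base ring *)

Section Homogeneity.
Variables (K : fieldType) (m : nat).
Implicit Types (p : {poly K}) (u v : nat).

(** The variable of [p] has degree [m], and [p] is the coefficient of a basis
    element of degree [v] in an element of degree [u]. *)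
Definition hom_poly u v p := forall s, p`_s != 0 -> u = (v + m * s)%N.

Lemma hom_poly0 u v : hom_poly u v 0.
Proof. by move=> s; rewrite coef0 eqxx. Qed.

Lemma hom_polyC u (c : K) : hom_poly u u c%:P.
Proof. by move=> [|s]; rewrite coefC ?eqxx // muln0 addn0. Qed.

Lemma hom_polysign n : hom_poly 0 0 ((-1) ^+ n).
Proof.
have -> : (-1) ^+ n = ((-1) ^+ n)%:P :> {poly K} by rewrite polyC_exp polyCN.
exact: hom_polyC.
Qed.

Lemma hom_polyXn u v s : u = (v + m * s)%N -> hom_poly u v 'X^s.
Proof. by move=> uv t; rewrite coefXn; have [->|] := eqVneq t s; rewrite ?eqxx. Qed.

Lemma hom_polyD u v p p' : hom_poly u v p -> hom_poly u v p' -> hom_poly u v (p + p').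
Proof.
move=> hp hp' s; rewrite coefD; have [/hp->//|/negbNE/eqP->] := boolP (p`_s != 0).
by rewrite add0r => /hp'.
Qed.

Lemma hom_polyN u v p : hom_poly u v p -> hom_poly u v (- p).
Proof. by move=> hp s; rewrite coefN oppr_eq0 => /hp. Qed.

Lemma hom_polyM u v u' v' p p' : hom_poly u v p -> hom_poly u' v' p' ->
  hom_poly (u + u') (v + v') (p * p').
Proof.
move=> hp hp' s; rewrite coefM => nz.
have [i _] : exists2 i : 'I_s.+1, true & p`_i * p'`_(s - i) != 0.
  apply/exists_inP; apply: contraNT nz => /exists_inPn z.
  by rewrite big1 // => i _; apply/eqP/negbNE/z.
rewrite mulf_eq0 negb_or => /andP[/hp-> /hp'->].
by have := ltn_ord i; nia.
Qed.

Lemma hom_poly_sum u v (I : Type) (r : seq I) (P : pred I) (F : I -> {poly K}) :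
  (forall i, P i -> hom_poly u v (F i)) -> hom_poly u v (\sum_(i <- r | P i) F i).
Proof.
move=> hF; apply: (big_ind (hom_poly u v)) => //; first exact: hom_poly0.
exact: hom_polyD.
Qed.

Lemma hom_poly_prod (I : Type) (r : seq I) (P : pred I) (u v : I -> nat)
    (F : I -> {poly K}) :
  (forall i, P i -> hom_poly (u i) (v i) (F i)) ->
  hom_poly (\sum_(i <- r | P i) u i)%N (\sum_(i <- r | P i) v i)%N
           (\prod_(i <- r | P i) F i).
Proof.
move=> hF; apply: (big_ind3 (fun a b c => hom_poly a b c)) => //.
  exact: hom_polyC.
by move=> *; exact: hom_polyM.
Qed.

Definition hom_mx (a b : nat) (u : 'I_a -> nat) (v : 'I_b -> nat)
  (M : 'M[{poly K}]_(a, b)) := forall i j, hom_poly (u i) (v j) (M i j).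

Lemma hom_mxM (a b c : nat) (u : 'I_a -> nat) (v : 'I_b -> nat)
    (w : 'I_c -> nat) M N :
  hom_mx u v M -> hom_mx v w N -> hom_mx u w (M *m N).
Proof.
move=> hM hN i j; rewrite mxE; apply: hom_poly_sum => k _ s.
by move/(hom_polyM (hM i k) (hN k j)); lia.
Qed.

Lemma hom_mxB (a b : nat) (u : 'I_a -> nat) (v : 'I_b -> nat) M N :
  hom_mx u v M -> hom_mx u v N -> hom_mx u v (M - N).
Proof.
by move=> hM hN i j; rewrite !mxE; apply: hom_polyD; last exact: hom_polyN.
Qed.

Lemma hom_mx_rowsub1 (a b : nat) (f : 'I_b -> 'I_a) (u : 'I_a -> nat) :
  hom_mx (u \o f) u (rowsub f 1%:M).
Proof.
move=> i j; rewrite !mxE; have [<-|_] := eqVneq (f i) j; first exact: hom_polyC.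
exact: hom_poly0.
Qed.

Lemma hom_mx_tr_rowsub1 (a b : nat) (f : 'I_b -> 'I_a) (u : 'I_a -> nat) :
  hom_mx u (u \o f) (rowsub f 1%:M)^T.
Proof.
move=> i j; rewrite !mxE; have [<-|_] := eqVneq (f j) i; first exact: hom_polyC.
exact: hom_poly0.
Qed.

Lemma hom_det (a : nat) (u v : 'I_a -> nat) M :
  hom_mx u v M -> hom_poly (\sum_i u i)%N (\sum_i v i)%N (\det M).
Proof.
move=> hM; apply: hom_poly_sum => s _.
rewrite [X in hom_poly _ X](reindex_inj (@perm_inj _ s)) /=.
have hs i : true -> hom_poly (u i) (v (s i)) (M i (s i)) by [].
exact: (hom_polyM (@hom_polysign s) (hom_poly_prod hs)).
Qed.

(** The cofactor of a row and a column has the degree of the determinant, less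
    the degrees of that row and column; the determinant has degree 0 here, so
    the adjugate has the degrees of an inverse. *)
Lemma hom_adj (a : nat) (u v : 'I_a -> nat) M :
  hom_mx u v M -> (\sum_i u i = \sum_i v i)%N -> hom_mx v u (\adj M).
Proof.
move=> hM euv i j s; rewrite mxE /cofactor => nz.
have hd : hom_mx (u \o lift j) (v \o lift i) (row' j (col' i M)).
  by move=> k l; rewrite !mxE; apply: hM.
have := hom_polyM (@hom_polysign _) (hom_det hd) nz.
have sum_lift (w : 'I_a -> nat) k : (\sum_i w i = w k + \sum_l (w \o lift k) l)%N.
  by rewrite (bigD1_ord k).
by move: euv; rewrite (sum_lift u j) (sum_lift v i); lia.
Qed.

End Homogeneity.

(** * Multiplication matrices *)

Section MonomialMatrices.
Variable I : finZmodType.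

(** The rank over the base ring of a free module with [q] generators; its basis
    consists of the products of a generator and a basis element of the
    algebra. *)
Definition base_rank (q : nat) := #|{: 'I_q * I}|.

(** Multiplication by the basis element of index [i], acting on row vectors, on
    a module in which the basis element of index [k] is sent to [c k i] times
    the one of index [k + i]. *)
Definition mon_mx (A : comNzRingType) q (c : I -> I -> A) (i : I) : 'M[A]_(base_rank q) :=
  \matrix_(s, t) if enum_val t == ((enum_val s).1, (enum_val s).2 + i)
                 then c (enum_val s).2 i else 0.

(** The presentation map: the generator [j] is sent to the basis element [g j],
    and hence its multiple by the basis element [k] of the algebra is sent to
    the row [g j] of [X k]. *)
Definition gen_mx (A : comNzRingType) q r (X : I -> 'M[A]_r) (g : 'I_q -> 'I_r) :
    'M[A]_(base_rank q, r) :=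
  \matrix_(s, l) X (enum_val s).2 (g (enum_val s).1) l.

Lemma map_mon_mx (A A' : comNzRingType) (f : {rmorphism A -> A'}) q c i :
  map_mx f (mon_mx q c i) = mon_mx q (fun k j => f (c k j)) i.
Proof. by apply/matrixP=> s t; rewrite !mxE; case: ifP; rewrite ?rmorph0. Qed.

Lemma map_gen_mx (A A' : comNzRingType) (f : {rmorphism A -> A'}) q r X
    (g : 'I_q -> 'I_r) :
  map_mx f (gen_mx X g) = gen_mx (fun k => map_mx f (X k)) g.
Proof. by apply/matrixP=> s l; rewrite !mxE. Qed.

Section Ring.
Variables (A : comNzRingType) (q : nat).
Implicit Types (c : I -> I -> A) (i j k : I).

Lemma mon_mxE c i p (M : 'M[A]_(base_rank q, p)) s l :
  (mon_mx q c i *m M) s l = c (enum_val s).2 i *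
    M (enum_rank ((enum_val s).1, (enum_val s).2 + i)) l.
Proof.
rewrite mxE (bigD1 (enum_rank ((enum_val s).1, (enum_val s).2 + i))) //=.
rewrite mxE enum_rankK eqxx big1 ?addr0 // => t tN; rewrite mxE ifN ?mul0r //.
by apply: contraNN tN => /eqP <-; rewrite enum_valK.
Qed.

Lemma mon_mxM c i c' j d : (forall k, c k i * c' (k + i) j = d * c k (i + j)) ->
  mon_mx q c i *m mon_mx q c' j = d *: mon_mx q c (i + j).
Proof.
move=> cc; apply/matrixP=> s t; rewrite mon_mxE !mxE enum_rankK /= addrA.
by case: eqP => _; rewrite ?mulr0 // cc.
Qed.

Lemma mon_mx0 c : (forall k, c k 0 = 1) -> mon_mx q c 0 = 1%:M.
Proof.
move=> c1; apply/matrixP=> s t; rewrite !mxE addr0 -surjective_pairing c1.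
by rewrite (inj_eq enum_val_inj) eq_sym; case: eqP.
Qed.

Variables (r : nat) (X : I -> 'M[A]_r) (g : 'I_q -> 'I_r) (C : I -> I -> A).
Hypothesis XM : forall i j, X i *m X j = C i j *: X (i + j).

(** The presentation map commutes with the action of the algebra. *)
Lemma mon_gen_mx i : mon_mx q C i *m gen_mx X g = gen_mx X g *m X i.
Proof.
apply/matrixP=> s l; rewrite mon_mxE !mxE enum_rankK /=.
under [RHS]eq_bigr do rewrite mxE.
by have /matrixP/(_ (g (enum_val s).1) l) := XM (enum_val s).2 i; rewrite !mxE.
Qed.

Lemma mul_gen_mx p (v : 'M[A]_(p, base_rank q)) :
  v *m gen_mx X g = \sum_j \sum_i col (enum_rank (j, i)) v *m row (g j) (X i).
Proof.
apply/matrixP=> a l; rewrite mxE pair_big summxE /=.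
rewrite [RHS](reindex_onto enum_val enum_rank) => /= [|ji _]; last by rewrite enum_rankK.
apply: eq_big => s; first by rewrite enum_valK eqxx.
by move=> _; rewrite !mxE big_ord1 !mxE -surjective_pairing enum_valK.
Qed.

End Ring.
End MonomialMatrices.

(** * Formal syzygy modules *)

Section Syzygies.
(* [B] is the ring of formal entries, [T] the set of semigroups of the face,
   [tau t] the substitution of the data of [t], with values in the polynomials
   in [y], and [w t] the degrees of the basis elements of the algebra.  The
   reduction [eps] modulo [y] is the same for all [t]. *)
Variables (K : fieldType) (I : finZmodType) (B : comNzRingType) (C : I -> I -> B).
Variables (T : Type) (m : nat).
Variables (tau : T -> {rmorphism B -> {poly K}}) (w : T -> I -> nat).
Variables (eps : {rmorphism B -> K}) (kap : K -> B).

Hypothesis m_gt0 : (0 < m)%N.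
Hypothesis tau_eps : forall t b, (tau t b).[0] = eps b.
Hypothesis tau_kap : forall t c, tau t (kap c) = c%:P.
Hypothesis w0 : forall t, w t 0 = 0%N.
Hypothesis w_gt0 : forall t i, i != 0 -> (0 < w t i)%N.
Hypothesis C0 : forall t k, tau t (C k 0) = 1.
Hypothesis tauC : forall t i j, exists2 s,
  tau t (C i j) = 'X^s & (w t i + w t j = w t (i + j)%R + m * s)%N.
Variable t0 : T.

Local Notation base_rank := (base_rank I).

(** Both sides are powers of [y] of the same degree. *)
Lemma tauC_assoc t k i j :
  tau t (C k i) * tau t (C (k + i) j) = tau t (C i j) * tau t (C k (i + j)).
Proof.
have [s1 -> e1] := tauC t k i; have [s2 -> e2] := tauC t (k + i) j.
have [s3 -> e3] := tauC t i j; have [s4 -> e4] := tauC t k (i + j).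
rewrite -!exprD; congr ('X^ _); apply/eqP; rewrite -(eqn_pmul2l m_gt0); apply/eqP.
move: e1 e2 e3 e4; rewrite addrA !mulnDr.
move: (w t _) (w t _) (w t _) (w t _) (w t _) (w t _) => *; lia.
Qed.

Lemma map_eps t a b (M : 'M[B]_(a, b)) :
  map_mx eps M = map_mx (horner_eval 0) (map_mx (tau t) M).
Proof. by apply/matrixP=> i j; rewrite !mxE /horner_eval tau_eps. Qed.

Definition wdeg t q (dN : 'I_q -> nat) (s : 'I_(base_rank q)) : nat :=
  dN (enum_val s).1 + w t (enum_val s).2.

Lemma hom_mon_mx t q (dN : 'I_q -> nat) i :
  hom_mx m (fun s => wdeg t dN s + w t i)%N (wdeg t dN)
    (map_mx (tau t) (mon_mx q C i)).
Proof.
move=> s s'; rewrite map_mon_mx mxE /wdeg; case: eqP => [->|_] /=.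
  have [e -> eE] := tauC t (enum_val s).2 i.
  by apply: hom_polyXn; rewrite -addnA eE addnA.
exact: hom_poly0.
Qed.

(** A module of syzygies in a free module with [q] generators.  The rows of
    [s_mx] are its basis over the base ring, [s_act] is the action of the
    algebra on that basis and [s_gen] selects the generators among the basis
    elements.  The degrees of the ambient generators and of the basis depend on
    the semigroup.  The number [q] is a parameter so that the next module of
    syzygies, which lies in a free module with [s_ngen] generators, has its
    type without a cast. *)
Record syz (q : nat) := Syz {
  s_rank : nat;
  s_mx : 'M[B]_(s_rank, base_rank q);
  s_act : I -> 'M[B]_s_rank;
  s_ngen : nat;
  s_gen : 'I_s_ngen -> 'I_s_rank;
  s_deg0 : T -> 'I_q -> nat;
  s_deg : T -> 'I_s_rank -> nat }.

Arguments s_gen {q} s _.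
Arguments s_deg0 {q} s _ _.
Arguments s_deg {q} s _ _.

Definition s_pres q (s : syz q) : 'M[B]_(base_rank (s_ngen s), s_rank s) :=
  gen_mx (s_act s) (s_gen s).

Definition s_rad q (s : syz q) : 'M[K]_(s_rank s) :=
  (\sum_(i | i != 0) map_mx eps (s_act s i))%MS.

(** What is required after substitution; the module axioms for [s_act] follow
    from the first two conditions, see [s_actM] and [s_act0]. *)
Definition specializes t q (s : syz q) : Prop :=
  [/\ forall p (v : 'M_(p, _)), v *m map_mx (tau t) (s_mx s) = 0 -> v = 0,
      forall i, map_mx (tau t) (s_act s i) *m map_mx (tau t) (s_mx s)
                = map_mx (tau t) (s_mx s) *m map_mx (tau t) (mon_mx q C i),
      hom_mx m (s_deg s t) (wdeg t (s_deg0 s t)) (map_mx (tau t) (s_mx s)) &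
      forall i, hom_mx m (fun l => s_deg s t l + w t i)%N (s_deg s t)
                  (map_mx (tau t) (s_act s i))].

(** The conditions modulo [y], common to all semigroups: the module lies in the
    maximal ideal times the ambient free module, and the selected basis elements
    are a basis modulo the maximal ideal. *)
Definition minimal q (s : syz q) : Prop :=
  [/\ forall l j, eps (s_mx s l (enum_rank (j, 0))) = 0,
      (1%:M <= rowsub (s_gen s) 1%:M + s_rad s)%MS &
      forall u : 'rV_(s_ngen s),
        (u *m rowsub (s_gen s) 1%:M <= s_rad s)%MS -> u = 0].

Definition valid q (s : syz q) := (forall t, specializes t s) /\ minimal s.

Definition resolves t q (s : syz q) (s' : syz (s_ngen s)) : Prop :=
  [/\ s_deg0 s' t = s_deg s t \o s_gen s,
      exists H, H *m map_mx (tau t) (s_pres s) = 1%:M,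
      map_mx (tau t) (s_mx s') *m map_mx (tau t) (s_pres s) = 0 &
      forall p (v : 'M_(p, _)), v *m map_mx (tau t) (s_pres s) = 0 ->
        exists u, v = u *m map_mx (tau t) (s_mx s')].

Section Step.
Variables (q : nat) (s : syz q).
Hypothesis s_valid : valid s.

(** The associativity relations hold only after substitution, not between the
    formal symbols, and so does this rule; it is inherited from the ambient free
    module, into which the module is embedded. *)
Lemma s_actM t i j :
  map_mx (tau t) (s_act s i) *m map_mx (tau t) (s_act s j)
  = tau t (C i j) *: map_mx (tau t) (s_act s (i + j)).
Proof.
have [inj act _ _] := s_valid.1 t; apply/eqP; rewrite -subr_eq0; apply/eqP/inj.
rewrite mulmxBl -mulmxA act mulmxA act -mulmxA -scalemxAl act !map_mon_mx.
rewrite (mon_mxM _ (d := tau t (C i j))) => [|k]; last exact: tauC_assoc.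
by rewrite -scalemxAr subrr.
Qed.

Lemma s_act0 t : map_mx (tau t) (s_act s 0) = 1%:M.
Proof.
have [inj act _ _] := s_valid.1 t; apply/eqP; rewrite -subr_eq0; apply/eqP/inj.
by rewrite mulmxBl act map_mon_mx mon_mx0 ?mulmx1 ?mul1mx ?subrr.
Qed.

Lemma hom_pres t :
  hom_mx m (wdeg t (s_deg s t \o s_gen s)) (s_deg s t) (map_mx (tau t) (s_pres s)).
Proof.
have [_ _ _ hX] := s_valid.1 t.
by move=> a l; rewrite map_gen_mx mxE; apply: hX.
Qed.

Lemma pres_act t i :
  map_mx (tau t) (mon_mx _ C i) *m map_mx (tau t) (s_pres s)
  = map_mx (tau t) (s_pres s) *m map_mx (tau t) (s_act s i).
Proof.
rewrite map_mon_mx map_gen_mx (mon_gen_mx (X := fun k => map_mx (tau t) (s_act s k))) //.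
exact: s_actM.
Qed.

(** Graded Nakayama modulo [y].  The row space of the presentation matrix is
    stable under the action and spans everything together with the images of the
    basis elements of positive degree.  Substituting this into itself pushes the
    part outside of the row space into larger and larger degrees. *)
Lemma pres_full : row_full (map_mx eps (s_pres s)).
Proof.
have [_ gen _] := s_valid.2; rewrite -sub1mx.
set P := map_mx eps (s_pres s); pose X i := map_mx eps (s_act s i).
have PX i p (A : 'M_(p, _)) : (A <= P -> A *m X i <= P)%MS.
  move=> AP; apply: submx_trans (submxMr _ AP) _.
  rewrite /P /X !(map_eps t0) -map_mxM -pres_act map_mxM.
  exact: submxMl.
have genP : (rowsub (s_gen s) 1%:M <= P)%MS.
  apply/row_subP => j; apply: submx_trans (row_sub (enum_rank (j, 0)) P).
  rewrite row_rowsub; suff -> : row (s_gen s j) 1%:M = row (enum_rank (j, 0)) P by [].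
  rewrite /P (map_eps t0) map_gen_mx; apply/rowP=> l.
  have /matrixP/(_ (s_gen s j) l) := s_act0 t0.
  by rewrite !mxE enum_rankK /horner_eval /= => ->; case: eqP; rewrite hornerC.
have [A1 A1P [W We]] : exists2 A1 : 'M_(s_rank s), (A1 <= P)%MS &
    exists W : I -> 'M_(s_rank s), 1%:M = A1 + \sum_(i | i != 0) W i *m X i.
  have /sub_addsmxP[[U V] /= e] := gen.
  exists (U *m rowsub (s_gen s) 1%:M).
    exact: submx_trans (submxMl _ _) genP.
  have /sub_sumsmxP[W We] := submxMl V (s_rad s).
  by exists W; rewrite [LHS]e We.
(* [U] is what remains of the identity outside of the row space. *)
have step d : exists T, (1%:M - T <= P)%MS /\
    forall k l, T k l != 0 -> (d <= s_deg s t0 l)%N.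
  elim: d => [|d [U [UP Ud]]]; first by exists 1%:M; rewrite subrr sub0mx.
  exists (\sum_(i | i != 0) W i *m U *m X i); split.
    rewrite [X in (X - _)]We -addrA addmx_sub // -sumrB summx_sub // => i _.
    rewrite -mulmxBl -[W i in X in (X - _)]mulmx1 -mulmxBr.
    by apply: PX; apply: submx_trans (submxMl _ _) UP.
  move=> k l; rewrite summxE => nz.
  have [i i0 {}nz] : exists2 i, i != 0 & (W i *m U *m X i) k l != 0.
    by apply/exists_inP; apply: contraNT nz => /exists_inPn z;
       rewrite big1 // => i /z/negbNE/eqP.
  have [j] : exists j, (W i *m U) k j * X i j l != 0.
    apply/existsP; apply: contraNT nz => /existsPn z.
    by rewrite mxE big1 // => j _; apply/eqP/negbNE/z.
  rewrite mulf_eq0 negb_or => /andP[nzU nzX].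
  have [a] : exists a, W i k a * U a j != 0.
    apply/existsP; apply: contraNT nzU => /existsPn z.
    by rewrite mxE big1 // => a _; apply/eqP/negbNE/z.
  rewrite mulf_eq0 negb_or => /andP[_ /Ud dj].
  have [_ _ _ hX] := s_valid.1 t0.
  move: nzX; rewrite /X (map_eps t0) mxE /horner_eval horner_coef0.
  by move/(hX i j l 0%N); have := w_gt0 t0 i0; lia.
have [U [UP Ud]] := step (\sum_l s_deg s t0 l).+1.
suff U0 : U = 0 by rewrite U0 subr0 in UP.
apply/matrixP=> k l; rewrite [RHS]mxE; apply/eqP/negP => /negP /Ud.
by rewrite (bigD1 l) //= ltnNge leq_addr.
Qed.

(** A block of the presentation matrix that is invertible modulo [y] has a
    determinant that is homogeneous with a nonzero constant term, hence a
    constant, which is the same for all semigroups.  So the adjugate divided by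
    that constant is an inverse of the block for all of them. *)
Lemma split_pres :
  exists (f : 'I_(s_rank s) -> 'I_(base_rank (s_ngen s))) (G : 'M[B]_(s_rank s)),
    injective f /\ forall t,
      let M := rowsub f (map_mx (tau t) (s_pres s)) in
      [/\ map_mx (tau t) G *m M = 1%:M, M *m map_mx (tau t) G = 1%:M &
        hom_mx m (s_deg s t) (wdeg t (s_deg s t \o s_gen s) \o f) (map_mx (tau t) G)].
Proof.
have [f [f_inj]] := rowsub_unit_exists pres_full; rewrite unitmxE unitfE.
set c := \det _ => c0; exists f, (kap c^-1 *: \adj (rowsub f (s_pres s))).
split=> // t M.
have hM : hom_mx m (wdeg t (s_deg s t \o s_gen s) \o f) (s_deg s t) M.
  by move=> k l; rewrite mxE; apply: hom_pres.
have defM : map_mx (tau t) (rowsub f (s_pres s)) = M by rewrite map_mxsub.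
have det0 : (\det M)`_0 = c.
  rewrite -horner_coef0 -[_.[0]]/(horner_eval 0 (\det M)) -det_map_mx /c.
  by rewrite (map_eps t) map_mxsub.
have sumE : (\sum_k (wdeg t (s_deg s t \o s_gen s) \o f) k = \sum_k s_deg s t k)%N.
  by have := hom_det hM (s := 0%N); rewrite det0 muln0 addn0; apply.
have detM : \det M = c%:P.
  apply/polyP=> -[|e]; rewrite coefC //=; apply/eqP/negP=> /negP /(hom_det hM).
  by rewrite sumE; move: m_gt0; nia.
have cV : c^-1%:P * c%:P = 1 :> {poly K} by rewrite -polyCM mulVf.
rewrite map_mxZ map_mx_adj defM tau_kap; split.
- by rewrite -scalemxAl mul_adj_mx detM scale_scalar_mx cV.
- by rewrite -scalemxAr mul_mx_adj detM scale_scalar_mx cV.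
- move=> k l; rewrite mxE -[X in hom_poly _ X]add0n -[X in hom_poly _ _ X]add0n.
  by apply: hom_polyM; [exact: hom_polyC | exact: hom_adj].
Qed.

(** With [Pi] the presentation matrix, [G] the inverse of its block of rows
    [f], and [Ef] the selection of those rows, [1 - Pi G Ef] is a projection onto
    the kernel of [Pi].  Its rows of index in the image of [f] vanish, and the
    other rows are a basis of the kernel: the coordinates of a kernel element in
    this basis are its own coordinates outside of the image of [f]. *)
Lemma next_syz : exists s' : syz (s_ngen s), valid s' /\ forall t, resolves t s'.
Proof.
have [f [G [f_inj splitG]]] := split_pres.
pose h := @codom_compl _ _ f.
pose Z := rowsub h 1%:M *m (1%:M - s_pres s *m G *m rowsub f 1%:M).
pose X i := Z *m mon_mx _ C i *m (rowsub h 1%:M)^T.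
have [n [g [gen_g ind_g]]] :=
  minimal_generators (\sum_(i | i != 0) map_mx eps (X i))%MS.
pose s' := @Syz (s_ngen s) _ Z X n g (fun t => s_deg s t \o s_gen s)
  (fun t => wdeg t (s_deg s t \o s_gen s) \o h).
pose Eh : 'M[{poly K}]_(codom_size f, _) := rowsub h 1%:M.
pose Ef : 'M[{poly K}]_(s_rank s, _) := rowsub f 1%:M.
pose Phi t := 1%:M - map_mx (tau t) (s_pres s) *m map_mx (tau t) G *m Ef.
have tauZ t : map_mx (tau t) Z = Eh *m Phi t.
  by rewrite map_mxM map_mxB !map_mxM !map_mxsub !map_mx1.
have tauX t i : map_mx (tau t) (X i) =
    map_mx (tau t) Z *m map_mx (tau t) (mon_mx _ C i) *m Eh^T.
  by rewrite !map_mxM -map_trmx map_mxsub map_mx1.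
have EfP t : Ef *m map_mx (tau t) (s_pres s) = rowsub f (map_mx (tau t) (s_pres s)).
  by rewrite mul_rowsub_mx mul1mx.
have PhiP t : Phi t *m map_mx (tau t) (s_pres s) = 0.
  have [GM _ _] := splitG t.
  by rewrite mulmxBl mul1mx -!mulmxA EfP GM mulmx1 subrr.
have EfPhi t : Ef *m Phi t = 0.
  have [_ MG _] := splitG t.
  by rewrite mulmxBr mulmx1 !mulmxA EfP MG mul1mx subrr.
have ker t p (v : 'M_(p, _)) : v *m map_mx (tau t) (s_pres s) = 0 ->
    v = v *m Eh^T *m map_mx (tau t) Z.
  move=> v0; have vPhi : v = v *m Phi t.
    by rewrite mulmxBr mulmx1 !mulmxA v0 !mul0mx subr0.
  rewrite [LHS]vPhi; transitivity (v *m (Ef^T *m Ef + Eh^T *m Eh) *m Phi t).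
    by rewrite (rowsub1_partition f_inj) mulmx1.
  by rewrite [X in X *m _ = _]mulmxDr mulmxDl -!mulmxA EfPhi !mulmx0 add0r tauZ.
have ZEh t : map_mx (tau t) Z *m Eh^T = 1%:M.
  rewrite tauZ /Phi mulmxBr mulmx1 mulmxBl (compl_mul_tr f) -!mulmxA.
  by rewrite (rowsub1_mul_compl_tr f) !mulmx0 subr0.
have ZP t : map_mx (tau t) Z *m map_mx (tau t) (s_pres s) = 0.
  by rewrite tauZ -mulmxA PhiP mulmx0.
have hZ t : hom_mx m (wdeg t (s_deg s t \o s_gen s) \o h)
    (wdeg t (s_deg s t \o s_gen s)) (map_mx (tau t) Z).
  have [_ _ hG] := splitG t.
  rewrite tauZ; apply: hom_mxM (hom_mx_rowsub1 _ _) _.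
  apply: hom_mxB.
    move=> a b; rewrite mxE; case: eqP => [->|_]; first exact: hom_polyC.
    exact: hom_poly0.
  apply: hom_mxM (hom_mx_rowsub1 _ _); apply: (hom_mxM (v := s_deg s t)) => //.
  exact: hom_pres.
exists s'; split; last first.
  move=> t; split=> //; first last.
  - by move=> p v /ker e; exists (v *m Eh^T).
  - have [GM _ _] := splitG t; exists (map_mx (tau t) G *m Ef).
    by rewrite -mulmxA EfP GM.
split=> [t|]; first split.
- by move=> p v vZ; rewrite -[v]mulmx1 -(ZEh t) mulmxA vZ mul0mx.
- by move=> i /=; rewrite tauX -ker // -mulmxA pres_act mulmxA ZP mul0mx.
- exact: hZ.
- move=> i; rewrite /s' /= tauX; apply: hom_mxM (hom_mx_tr_rowsub1 _ _).
  apply: (hom_mxM (v := fun a => wdeg t (s_deg s t \o s_gen s) a + w t i)%N).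
    by move=> a b e /(hZ t a b e) /= ->; rewrite addnAC.
  exact: hom_mon_mx.
split=> //= l j.
have [_ _ ind] := s_valid.2.
pose u := \row_j (map_mx eps Z) l (enum_rank (j, 0)).
suff : u = 0 by move/rowP/(_ j); rewrite !mxE.
apply: ind.
(* A relation between the generators, read modulo the maximal ideal, only keeps
   the coefficients of the basis element 1 of the algebra. *)
have : row l (map_mx eps Z) *m map_mx eps (s_pres s) = 0.
  by rewrite -row_mul !(map_eps t0) -map_mxM ZP map_mx0 row0.
rewrite map_gen_mx mul_gen_mx exchange_big (bigD1 0) //=.
move/eqP; rewrite addr_eq0 => /eqP e.
have -> : u *m rowsub (s_gen s) 1%:M = - \sum_(i | i != 0) \sum_k
    col (enum_rank (k, i)) (row l (map_mx eps Z))
      *m row (s_gen s k) (map_mx eps (s_act s i)).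
  rewrite -e mulmx_sum_row; apply: eq_bigr => k _.
  rewrite row_rowsub (map_eps t0 (s_act s 0)) s_act0 map_mx1.
  by apply/rowP=> a; rewrite !mxE big_ord1 !mxE.
rewrite -sumrN summx_sub // => i i0; rewrite -sumrN summx_sub // => k _.
rewrite eqmx_opp; apply: submx_trans (submxMl _ _) _.
by apply: submx_trans (row_sub _ _) _; apply: (sumsmx_sup i).
Qed.

End Step.

Lemma syz_choice : exists next : forall q (s : syz q), syz (s_ngen s),
  forall q (s : syz q), valid s ->
    valid (next q s) /\ forall t, resolves t (next q s).
Proof.
have ex q (s : syz q) : exists s' : syz (s_ngen s),
    valid s -> valid s' /\ forall t, resolves t s'.
  have [/next_syz[s' s'P]|sN] := pselect (valid s); first by exists s'.
  by exists (@Syz _ 0 0 (fun=> 0) 0 (fun i => i) (fun _ _ => 0%N) (fun _ _ => 0%N)).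
by exists (fun q s => projT1 (cid (ex q s))) => q s; apply: projT2 (cid (ex q s)).
Qed.

Variables (y : B) (E : I -> I -> B).
Hypothesis tau_y : forall t, tau t y = 'X.

(* The degrees of the basis [y, x_1, ..., x_(m-1)] of the maximal ideal. *)
Let u t (k : I) : nat := if k == 0 then m else w t k.

Hypothesis tauE : forall t k i, exists2 s,
  tau t (E k i) = 'X^s & (u t k + w t i = u t (k + i)%R + m * s)%N.

Let z (k : I) : B := if k == 0 then y else 1.

Lemma tau_z t k : exists2 s, tau t (z k) = 'X^s & (u t k = w t k + m * s)%N.
Proof.
rewrite /z /u; have [->|_] := eqVneq k 0.
  by exists 1%N; rewrite ?expr1 ?tau_y // w0 muln1.
by exists 0%N; rewrite ?rmorph1 ?expr0 ?muln0 ?addn0.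
Qed.

(** The maximal ideal as a module of syzygies in a free module of rank 1.  An
    element lies in it exactly when its coordinate on 1, which is a polynomial
    in [y], has no constant term. *)
Lemma first_syz : exists s : syz 1,
  [/\ valid s, forall t j, s_deg0 s t j = 0%N &
    forall t (v : 'rV_(base_rank 1)), (v 0 (enum_rank (0, 0))).[0] = 0 <->
      exists c, v = c *m map_mx (tau t) (s_mx s)].
Proof.
pose Z : 'M[B]_(base_rank 1) := diag_mx (\row_s z (enum_val s).2).
have [n [g [gen_g ind_g]]] :=
  minimal_generators (\sum_(i | i != 0) map_mx eps (mon_mx 1 E i))%MS.
pose s := @Syz 1 _ Z (mon_mx 1 E) n g (fun _ _ => 0%N)
  (fun t a => u t (enum_val a).2).
have tauZ t : map_mx (tau t) Z = diag_mx (\row_s tau t (z (enum_val s).2)).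
  by rewrite map_diag_mx; congr diag_mx; apply/rowP=> a; rewrite !mxE.
exists s; split=> //; last first.
  move=> t v; rewrite /s /= tauZ; split=> [v0|[c ->]]; last first.
    by rewrite mul_mx_diag !mxE enum_rankK /z eqxx tau_y hornerMX mulr0.
  have /factor_theorem[p vE] : root (v 0 (enum_rank (0, 0))) 0 by apply/rootP.
  exists (\row_a if (enum_val a).2 == 0 then p else v 0 a).
  apply/rowP=> a; rewrite mul_mx_diag !mxE /z; case: eqP => a0.
    rewrite tau_y -['X]subr0 -polyC0 -vE -[in LHS](enum_valK a).
    by case: (enum_val a) a0 => j k /= ->; rewrite ord1.
  by rewrite rmorph1 mulr1.
split=> [t|]; first split.
- move=> p v; rewrite /s /= tauZ mul_mx_diag => /matrixP v0.
  apply/matrixP=> a b; have /eqP := v0 a b; rewrite !mxE mulf_eq0.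
  have [e -> _] := tau_z t (enum_val b).2.
  by rewrite expf_eq0 polyX_eq0 andbF orbF => /eqP.
- move=> i; rewrite /s /= tauZ !map_mon_mx mul_diag_mx.
  apply/matrixP=> a b; rewrite mon_mxE !mxE enum_rankK.
  rewrite -(inj_eq enum_val_inj) enum_rankK [in RHS]eq_sym.
  case: eqP => _; rewrite ?mulr0 // mulr1n /=.
  set k := (enum_val a).2; have [e1 -> h1] := tauE t k i.
  have [e2 -> h2] := tau_z t (k + i); have [e3 -> h3] := tau_z t k.
  have [e4 -> h4] := tauC t k i; rewrite -!exprD; congr ('X^ _).
  apply/eqP; rewrite -(eqn_pmul2l m_gt0); apply/eqP; rewrite !mulnDr.
  by move: (u t _) (w t _) (w t _) (w t _) (u t _) h1 h2 h3 h4 => *; lia.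
- move=> a b; rewrite /s /= tauZ !mxE /wdeg add0n; case: eqP => [->|_].
    by have [e -> h] := tau_z t (enum_val b).2; apply: hom_polyXn.
  exact: hom_poly0.
- move=> i a b; rewrite /s /= map_mon_mx mxE; case: eqP => [->|_].
    by have [e -> h] := tauE t (enum_val a).2 i; apply: hom_polyXn.
  exact: hom_poly0.
split=> //= l j; rewrite !mxE.
case: eqP => [->|_]; last by rewrite rmorph0.
by rewrite enum_rankK /z eqxx mulr1n -(tau_eps t0) tau_y hornerX.
Qed.

Section Tower.
Variables (s0 : syz 1) (next : forall q (s : syz q), syz (s_ngen s)).
Hypothesis s0_valid : valid s0.
Hypothesis nextP : forall q (s : syz q), valid s ->
  valid (next s) /\ forall t, resolves t (next s).

(** The number of ambient generators varies along the sequence, hence the pair. *)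
Fixpoint tower k : {q & syz q} :=
  if k is k'.+1 then existT _ (s_ngen (projT2 (tower k'))) (next (projT2 (tower k')))
  else existT _ 1%N s0.

Lemma tower_valid k : valid (projT2 (tower k)).
Proof. by elim: k => [|k IH] //=; have [] := nextP IH. Qed.

Lemma tower_resolves t k : @resolves t _ (projT2 (tower k)) (projT2 (tower k.+1)).
Proof. by have [_] := nextP (tower_valid k). Qed.

End Tower.
End Syzygies.

Arguments s_gen {I B T q} s _.

(** * Coordinates over the base ring *)

Section Coordinates.
Variables (P A : comNzRingType) (I : finZmodType) (c : I -> I -> P).
Variables (ev : {rmorphism P -> A}) (beta : I -> A).

Definition combination (a : I -> P) : A := \sum_k ev (a k) * beta k.

(** The element of a free module of rank [q] over the algebra with given
    coordinates over the base ring. *)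
Definition column q (v : 'rV[P]_(base_rank I q)) : 'cV[A]_q :=
  \col_j combination (fun k => v 0 (enum_rank (j, k))).

Lemma columnD q : {morph @column q : v v' / v + v'}.
Proof.
move=> v v'; apply/colP=> j; rewrite !mxE -big_split.
by apply: eq_bigr => k _; rewrite mxE rmorphD mulrDl.
Qed.

Lemma columnZ q a (v : 'rV[P]_(base_rank I q)) : column (a *: v) = ev a *: column v.
Proof.
apply/colP=> j; rewrite !mxE mulr_sumr.
by apply: eq_bigr => k _; rewrite mxE rmorphM mulrA.
Qed.

Lemma column0 q : column (0 : 'rV[P]_(base_rank I q)) = 0.
Proof. by rewrite -(scale0r 0) columnZ rmorph0 scale0r. Qed.

Lemma columnB q : {morph @column q : v v' / v - v'}.
Proof. by move=> v v'; rewrite columnD -scaleN1r columnZ rmorphN1 scaleN1r. Qed.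

Lemma column_sum q (J : finType) (F : J -> 'rV[P]_(base_rank I q)) :
  column (\sum_j F j) = \sum_j column (F j).
Proof. exact: (big_morph _ (@columnD q) (column0 q)). Qed.

Hypothesis betaM : forall i j, beta i * beta j = ev (c i j) * beta (i + j).

Lemma column_mon q (v : 'rV[P]_(base_rank I q)) i :
  column (v *m mon_mx q c i) = beta i *: column v.
Proof.
apply/colP=> j; rewrite !mxE mulr_sumr.
rewrite [LHS](reindex_inj (addIr i)) /=; apply: eq_bigr => k _.
rewrite mxE (bigD1 (enum_rank (j, k))) //= big1 => [|t tN]; last first.
  rewrite mxE enum_rankK; case: eqP => [[ej ek]|_]; last by rewrite mulr0.
  move/(congr1 (+%R^~ (- i))): ek; rewrite !addrK => ek.
  by case/negP: tN; rewrite ej ek -surjective_pairing enum_valK.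
by rewrite mxE !enum_rankK eqxx addr0 rmorphM -mulrA -betaM [beta k * _]mulrC mulrCA.
Qed.

Hypothesis beta_span : forall f, exists a, f = combination a.
Hypothesis beta_free : forall a, combination a = 0 -> forall k, a k = 0.

Lemma column_inj q (v : 'rV[P]_(base_rank I q)) : column v = 0 -> v = 0.
Proof.
move=> /colP v0; apply/rowP=> s; rewrite mxE.
have := v0 (enum_val s).1; rewrite !mxE => /beta_free /(_ (enum_val s).2).
by rewrite -surjective_pairing enum_valK.
Qed.

Lemma column_surj q (x : 'cV[A]_q) : exists v, x = column v.
Proof.
have [a aP] := boolp.choice (fun j => beta_span (x j 0)).
exists (\row_s a (enum_val s).1 (enum_val s).2); apply/colP=> j.
by rewrite mxE aP; apply: eq_bigr => k _; rewrite mxE enum_rankK.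
Qed.

(** The generator [l] of the source is sent to the syzygy [g l]. *)
Definition boundary q r q' (Z : 'M[P]_(r, base_rank I q)) (g : 'I_q' -> 'I_r) :
    'M[A]_(q, q') :=
  \matrix_(j, l) column (row (g l) Z) j 0.

(** In coordinates over the base ring, a boundary map is the presentation map of
    the syzygies followed by their inclusion. *)
Lemma boundary_column q r q' (Z : 'M[P]_(r, base_rank I q)) (X : I -> 'M[P]_r)
    (g : 'I_q' -> 'I_r) (v : 'rV[P]_(base_rank I q')) :
  (forall i, X i *m Z = Z *m mon_mx q c i) ->
  boundary Z g *m column v = column (v *m gen_mx X g *m Z).
Proof.
move=> XZ; rewrite mul_gen_mx mulmx_suml column_sum; apply/colP=> j.
rewrite mxE summxE; apply: eq_bigr => l _; rewrite mulmx_suml column_sum.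
rewrite summxE [boundary _ _ _ _]mxE [column v _ _]mxE /combination mulr_sumr.
apply: eq_bigr => k _.
have -> : col (enum_rank (l, k)) v *m row (g l) (X k) *m Z
    = v 0 (enum_rank (l, k)) *: (row (g l) Z *m mon_mx q c k).
  rewrite -mulmxA -row_mul XZ row_mul (mx11_scalar (col _ v)) mul_scalar_mx.
  by rewrite mxE.
rewrite columnZ column_mon; set x := column _.
have -> : (ev (v 0 (enum_rank (l, k))) *: (beta k *: x)) j 0
    = ev (v 0 (enum_rank (l, k))) * (beta k * x j 0) by rewrite !mxE.
by rewrite mulrC mulrA.
Qed.

End Coordinates.

(** * Kunz coordinates of numerical semigroups *)

Section AperyArithmetic.
Local Open Scope nat_scope.
Variables (S : set nat) (m : nat).
Hypotheses (numS : numerical_semigroup S) (multS : multiplicity S m).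
Local Notation a := (apery_elt S m).

Let m_gt0 : 0 < m. Proof. by case: multS. Qed.

Lemma apery_elt_dvd i : m %| i -> a i = m.
Proof. by rewrite /apery_elt => ->. Qed.

Lemma apery_elt_mod i : a i = i %[mod m].
Proof.
have [mi|/(apery_eltP numS multS)[]//] := boolP (m %| i).
by rewrite apery_elt_dvd // modnn; apply/esym/eqP.
Qed.

Lemma apery_elt_in i : S (a i).
Proof.
have [mi|/(apery_eltP numS multS)[[]]//] := boolP (m %| i).
by rewrite apery_elt_dvd //; case: multS.
Qed.

Lemma apery_elt_ge i : m <= a i.
Proof.
have [mi|mi] := boolP (m %| i); first by rewrite apery_elt_dvd.
have [_ _ mmin] := multS; apply: mmin; first exact: apery_elt_in.
rewrite lt0n; apply: contraNN mi => /eqP a0.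
by rewrite /dvdn -apery_elt_mod a0 mod0n.
Qed.

Lemma apery_elt_gt i : ~~ (m %| i) -> m < a i.
Proof.
move=> mi; rewrite ltn_neqAle apery_elt_ge andbT; apply: contraNneq mi => am.
by rewrite /dvdn -apery_elt_mod -am modnn.
Qed.

Lemma apery_elt_min i n : S n -> 0 < n -> n = i %[mod m] -> a i <= n.
Proof.
move=> Sn n_gt0 ni; have [mi|mi] := boolP (m %| i).
  by rewrite apery_elt_dvd //; case: multS => _ _; apply.
have [[_ aN] ai] := apery_eltP numS multS mi.
rewrite leqNgt; apply/negP => na; apply: aN.
have [k ak] : exists k, a i = n + k.+1 * m.
  have /eqP : a i = n %[mod m] by rewrite ai ni.
  rewrite eqn_mod_dvd ?(ltnW na) // => /dvdnP[[|k] e].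
    by move: na; rewrite -subn_gt0 e mul0n.
  by exists k; rewrite -e subnKC // ltnW.
have [_ addS _] := numS; have [Sm _ _] := multS.
rewrite ak mulSn; split; first by lia.
rewrite [m + _]addnC addnA addnK; elim: k {ak} => [|k IH]; first by rewrite addn0.
by rewrite mulSn addnCA; apply: addS.
Qed.

Lemma eq_apery_elt i j : i = j %[mod m] -> a i = a j.
Proof.
move=> ij; apply/eqP; rewrite eqn_leq !apery_elt_min //; do ?exact: apery_elt_in.
all: by rewrite ?(leq_trans m_gt0 (apery_elt_ge _)) // apery_elt_mod.
Qed.

Lemma kunz_bE i j : a i + a j = a (i + j) + m * kunz_b S m i j.
Proof.
have le : a (i + j) <= a i + a j.
  apply: apery_elt_min; first by case: numS => _ + _; apply; apply: apery_elt_in.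
    by rewrite addn_gt0 (leq_trans m_gt0 (apery_elt_ge _)).
  by rewrite -modnDm !apery_elt_mod modnDm.
rewrite /kunz_b mulnC divnK ?subnKC // -eqn_mod_dvd // eq_sym.
by rewrite apery_elt_mod -[X in _ == X]modnDm !apery_elt_mod modnDm.
Qed.

(** Here [a_(i + j)] is the multiplicity [m], while [a_i > m] and [a_j >= m]. *)
Lemma kunz_b_gt0 i j : ~~ (m %| i) -> m %| i + j -> 0 < kunz_b S m i j.
Proof.
move=> mi mij; have := kunz_bE i j; rewrite (apery_elt_dvd mij).
have := apery_elt_gt mi; have := apery_elt_ge j; case: kunz_b => // ; lia.
Qed.

End AperyArithmetic.

Section RelativeInterior.
Variables (R : realType) (m : nat) (F : set 'rV[R]_m.-1).
Hypothesis F_sub : forall z, F z -> kunz_cone R m z.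

(** One can move from [p] slightly away from [q] without leaving the face; if an
    inequality is tight at [p] and strict at [q], it fails after this move. *)
Lemma relint_tight (p q : 'rV[R]_m.-1) (i j l : 'I_m.-1) :
  (l.+1 = i.+1 + j.+1 %[mod m])%N ->
  relative_interior F p -> F q -> p 0 l = p 0 i + p 0 j -> q 0 l = q 0 i + q 0 j.
Proof.
move=> lij [Fp [e e0 ball]] Fq pE.
(* [M] bounds the coordinates of [p - q], so that [x] is within [e] of [p]. *)
pose M : R := 1 + \sum_k `|p 0 k - q 0 k|.
have M_gt0 : 0 < M by rewrite ltr_pwDl // sumr_ge0.
pose d := e / M; have d_gt0 : 0 < d by rewrite divr_gt0.
pose x := p + d *: (p - q).
have Fx : F x.
  apply: ball.
    exists 2%N, (fun k => if k == 0 then 1 + d else - d),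
      (fun k => if k == 0 then p else q).
    rewrite !big_ord_recl !big_ord0 /= !addr0; split.
    - by move=> k; case: eqP.
    - by rewrite addrK.
    - by rewrite /x scalerDl scale1r scalerBr scaleNr addrA.
  move=> k; rewrite !mxE addrAC subrr add0r normrM gtr0_norm //.
  rewrite /d -mulrA gtr_pMr // mulrC ltr_pdivrMr // mul1r /M.
  rewrite (bigD1 k) //= addrCA ltrDl ltr_pwDl // sumr_ge0 //.
have [_ /(_ i j l lij)] := F_sub Fx; rewrite !mxE pE => le1.
have [_ /(_ i j l lij) le2] := F_sub Fq; apply/eqP; rewrite eq_le le2 /=.
rewrite -subr_le0 -(pmulr_rle0 _ d_gt0).
rewrite -subr_ge0 in le1; rewrite -oppr_ge0; apply: le_trans le1 _.
by rewrite le_eqVlt; apply/orP; left; apply/eqP; lra.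
Qed.

End RelativeInterior.

(** * The semigroup algebra as a module over the base ring *)

Lemma mpoly_rmorph_ext (k : nat) (A A' : comNzRingType)
    (f g : {rmorphism {mpoly A[k]} -> A'}) :
  (forall c, f c%:MP = g c%:MP) -> (forall i, f 'X_i = g 'X_i) -> f =1 g.
Proof.
move=> fgC fgX p; rewrite [p]mpolyE !rmorph_sum; apply: eq_bigr => mu _.
rewrite -mul_mpolyC !rmorphM fgC mpolyXE_id !rmorph_prod; congr (_ * _).
by apply: eq_bigr => i _; rewrite !rmorphXn fgX.
Qed.

Section SemigroupAlgebra.
Variables (K : fieldType) (n : nat) (S : set nat).
Local Notation m := n.+2.
Local Notation A := (semigroup_algebra K m S).
Local Notation a := (apery_elt S m).
Implicit Types (p q : {mpoly K[m]}) (f g : A).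

(** The embedding of the semigroup algebra into the polynomials in [t]. *)
Definition toric (f : A) : {poly K} := toric_map S (repr f).

Lemma alg_pi_eq p q : (alg_pi S p = alg_pi S q) <-> toric_map S p = toric_map S q.
Proof.
have e : (alg_pi S p == alg_pi S q) = (toric_map S (p - q) == 0).
  by rewrite -[RHS]/((p - q) \in toric_ideal S) Quotient.idealrBE.
by rewrite rmorphB subr_eq0 in e; split=> /eqP; [rewrite e | rewrite -e] => /eqP.
Qed.

Lemma alg_pi_repr f : alg_pi S (repr f) = f. Proof. exact: reprK. Qed.

Lemma toricE p : toric (alg_pi S p) = toric_map S p.
Proof. by apply/alg_pi_eq; rewrite alg_pi_repr. Qed.

Lemma toric_inj : injective toric.
Proof.
by move=> f g; rewrite -[f]alg_pi_repr -[g]alg_pi_repr !toricE => /alg_pi_eq.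
Qed.

Lemma toric_zmod : zmod_morphism toric.
Proof.
move=> f g; rewrite -[f]alg_pi_repr -[g]alg_pi_repr -rmorphB !toricE.
exact: rmorphB.
Qed.

Lemma toric_monoid : monoid_morphism toric.
Proof.
split; first by rewrite -[1](rmorph1 (alg_pi S)) toricE rmorph1.
move=> f g; rewrite -[f]alg_pi_repr -[g]alg_pi_repr -rmorphM !toricE.
exact: rmorphM.
Qed.

HB.instance Definition _ := GRing.isZmodMorphism.Build A {poly K} toric toric_zmod.
HB.instance Definition _ := GRing.isMonoidMorphism.Build A {poly K} toric toric_monoid.

Lemma toric_var i : toric (alg_var K S i) = 'X^(a i).
Proof. by rewrite toricE /toric_map mmapX mmap1U. Qed.

Lemma toric_const c : toric (alg_const m S c) = c%:P.
Proof. by rewrite toricE /toric_map mmapC. Qed.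

(** The inclusion of the polynomials in [y]. *)
Definition base_eval : {rmorphism {poly K} -> A} :=
  horner_morph (fun c => mulrC (alg_var K S ord0) (alg_const m S c)).

Lemma base_evalX : base_eval 'X = alg_var K S ord0.
Proof. exact: horner_morphX. Qed.

Lemma base_evalC c : base_eval c%:P = alg_const m S c.
Proof. exact: horner_morphC. Qed.

Lemma toric_base_eval (p : {poly K}) : toric (base_eval p) = p \Po 'X^m.
Proof.
elim/poly_ind: p => [|p c IH]; first by rewrite !rmorph0.
rewrite !rmorphD !rmorphM /= -/(base_eval p) -/(base_eval 'X) -/(base_eval c%:P).
rewrite IH base_evalX base_evalC toric_var toric_const.
by rewrite comp_polyX comp_polyC apery_elt_dvd.
Qed.

Definition apery_basis (k : 'I_m) : A := if k == 0 then 1 else alg_var K S k.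
Definition apery_deg (k : 'I_m) : nat := if k == 0 then 0%N else a k.

Lemma toric_apery_basis k : toric (apery_basis k) = 'X^(apery_deg k).
Proof.
by rewrite /apery_basis /apery_deg; case: eqP => _; rewrite ?rmorph1 ?toric_var.
Qed.

Local Notation combination := (combination base_eval apery_basis).

Lemma toric_combination c :
  toric (combination c) = \sum_k (c k \Po 'X^m) * 'X^(apery_deg k).
Proof.
rewrite rmorph_sum; apply: eq_bigr => k _.
by rewrite rmorphM /= toric_base_eval toric_apery_basis.
Qed.

Hypotheses (numS : numerical_semigroup S) (multS : multiplicity S m).

Lemma apery_deg_mod k : apery_deg k = k %[mod m].
Proof.
rewrite /apery_deg; case: eqP => [->|_]; first by [].
exact: apery_elt_mod.
Qed.

Lemma apery_deg_gt0 k : k != 0 -> (0 < apery_deg k)%N.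
Proof.
rewrite /apery_deg => /negPf ->.
exact: leq_trans (apery_elt_ge numS multS _).
Qed.

(** The images in the polynomials in [t] have exponents in distinct residue
    classes modulo [m]. *)
Lemma apery_basis_free c : combination c = 0 -> forall k, c k = 0.
Proof.
move=> c0 k; apply/polyP=> s; rewrite coef0.
have /(congr1 (fun p : {poly K} => p`_(m * s + apery_deg k))) := toric_combination c.
rewrite c0 rmorph0 coef0 coef_sum (bigD1 k) //= coefMXn ltnNge leq_addl /=.
rewrite addnK coef_comp_poly_Xn // dvdn_mulr // mulKn // big1 ?addr0 // => l lk.
rewrite coefMXn; case: ltnP => // le; rewrite coef_comp_poly_Xn //.
case: ifP => // dv; case/eqP: lk; apply/val_inj => /=.
rewrite -(modn_small (ltn_ord l)) -(modn_small (ltn_ord k)) -!apery_deg_mod.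
by move: dv; rewrite -eqn_mod_dvd // mulnC modnMDl => /eqP.
Qed.

Definition spanned f := exists c, f = combination c.

Lemma spannedD f g : spanned f -> spanned g -> spanned (f + g).
Proof.
move=> [c ->] [d ->]; exists (fun k => c k + d k); rewrite -big_split.
by apply: eq_bigr => k _; rewrite rmorphD mulrDl.
Qed.

Lemma spanned0 : spanned 0.
Proof.
exists (fun=> 0); rewrite /combination big1 // => k _.
by rewrite rmorph0 mul0r.
Qed.

Lemma spanned_sum (J : finType) (F : J -> A) :
  (forall j, spanned (F j)) -> spanned (\sum_j F j).
Proof. by move=> sF; apply: big_ind => //; [exact: spanned0 | exact: spannedD]. Qed.

Lemma spanned_basis (p : {poly K}) k : spanned (base_eval p * apery_basis k).
Proof.
exists (fun j => if j == k then p else 0); rewrite /combination (bigD1 k) //= eqxx.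
by rewrite big1 ?addr0 // => j /negPf ->; rewrite rmorph0 mul0r.
Qed.

Lemma spannedZ (p : {poly K}) f : spanned f -> spanned (base_eval p * f).
Proof.
move=> [c ->]; rewrite mulr_sumr; apply: spanned_sum => k.
by rewrite mulrA -rmorphM; apply: spanned_basis.
Qed.

Variable s : 'I_m -> 'I_m -> nat.
Hypothesis apery_degD :
  forall i j, (apery_deg i + apery_deg j = apery_deg (i + j)%R + m * s i j)%N.

Lemma apery_basisM i j :
  apery_basis i * apery_basis j = base_eval 'X^(s i j) * apery_basis (i + j).
Proof.
apply: toric_inj; rewrite !rmorphM /= !toric_apery_basis toric_base_eval.
by rewrite comp_Xn_poly -exprM -!exprD apery_degD addnC.
Qed.

Lemma apery_basis_span f : spanned f.
Proof.
have spanned_var i g : spanned g -> spanned (alg_var K S i * g).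
  have [->|i0] := eqVneq i 0; first by rewrite -base_evalX; apply: spannedZ.
  move=> [c ->]; rewrite mulr_sumr; apply: spanned_sum => k.
  have -> : alg_var K S i = apery_basis i by rewrite /apery_basis (negPf i0).
  by rewrite mulrCA apery_basisM; apply/spannedZ/spanned_basis.
rewrite -[f]alg_pi_repr [repr f]mpolyE rmorph_sum.
apply: big_ind => [||mu _]; [exact: spanned0 | exact: spannedD |].
rewrite -mul_mpolyC rmorphM -[X in X * _]/(alg_const m S _) -base_evalC.
apply: spannedZ; rewrite mpolyXE_id rmorph_prod -[\prod_i _]mulr1.
have spanned1 : spanned 1.
  by have := spanned_basis 1 0; rewrite rmorph1 mul1r /apery_basis eqxx.
suff gen g : spanned g -> spanned (\prod_i alg_pi S ('X_i ^+ mu i) * g) by apply: gen.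
move: g; apply: (big_ind (fun x => forall g, spanned g -> spanned (x * g)))
  => [g|g h Hg Hh e se|i _ g sg].
- by rewrite mul1r.
- by rewrite -mulrA; apply/Hg/Hh.
- rewrite rmorphXn; elim: (mu i) => [|e IH]; first by rewrite mul1r.
  by rewrite exprS -mulrA; apply: spanned_var.
Qed.

(** The ideal generated by the variables consists of the elements whose image
    in the polynomials in [t] has no constant term. *)
Lemma gen_ideal_combination c :
  combination c \in gen_ideal (alg_var K S) <-> (c 0).[0] = 0.
Proof.
split=> [/gen_idealP[d e]|].
  have <- : horner_eval 0 (toric (combination c)) = (c 0).[0].
    rewrite toric_combination rmorph_sum (bigD1 0) //= big1 => [|k k0].
      rewrite /horner_eval /apery_deg eqxx expr0 mulr1 addr0.
      by rewrite horner_comp hornerXn expr0n.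
    have := apery_deg_gt0 k0; case: (apery_deg k) => // e' _.
    by rewrite rmorphM /= /horner_eval hornerXn expr0n mulr0.
  rewrite e (raddf_sum toric) (raddf_sum (horner_eval 0)) big1 // => i _.
  rewrite -[LHS]/(horner_eval 0 (toric (d i * alg_var K S i))).
  have -> : toric (d i * alg_var K S i) = toric (d i) * 'X^(a i).
    by rewrite -toric_var; apply: toric_monoid.2.
  rewrite rmorphM /=.
  have := apery_elt_ge numS multS i; case: (a i) => // e' _.
  by rewrite /horner_eval hornerXn expr0n mulr0.
move=> /eqP/factor_theorem[p]; rewrite subr0 => c0.
apply/gen_idealP; exists (fun k => if k == 0 then base_eval p else base_eval (c k)).
apply: eq_bigr => k _; rewrite /apery_basis; case: eqP => [->|//].
by rewrite c0 rmorphM base_evalX mulr1.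
Qed.

Lemma alg_homogD z f g : alg_homog z f -> alg_homog z g -> alg_homog z (f + g).
Proof.
move=> [p -> hp] [q -> hq]; exists (p + q); first by rewrite rmorphD.
move=> mu /msuppD_le; rewrite mem_cat => /orP[/hp|/hq] //.
Qed.

Lemma alg_homogM z z' f g :
  alg_homog z f -> alg_homog z' g -> alg_homog (z + z') (f * g).
Proof.
move=> [p -> hp] [q -> hq]; exists (p * q); first by rewrite rmorphM.
move=> mu /msuppM_le /allpairsP[[mu1 mu2] /= [/hp <- /hq <- ->]].
rewrite -PoszD -big_split; congr Posz; apply: eq_bigr => i _.
by rewrite mnmDE mulnDl.
Qed.

Lemma alg_homog_const (c : K) : alg_homog 0 (alg_const m S c).
Proof.
exists c%:MP => // mu; rewrite msuppC; case: ifP => // _; rewrite inE => /eqP ->.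
by rewrite big1 // => i _; rewrite mnm0E mul0n.
Qed.

Lemma alg_homog_var (i : 'I_m) : @alg_homog K m S (a i)%:Z (alg_var K S i).
Proof.
exists 'X_i => // mu; rewrite msuppX inE => /eqP ->; congr Posz.
rewrite (bigD1 i) //= mnm1E eqxx mul1n big1 ?addn0 // => j ji.
by rewrite mnm1E eq_sym (negPf ji) mul0n.
Qed.

Lemma alg_homog_combination (d e : nat) c :
  (forall k, hom_poly m d (e + apery_deg k) (c k)) ->
  alg_homog (d%:Z - e%:Z) (combination c).
Proof.
have homog0 z : alg_homog z (0 : A).
  by exists 0 => [|mu]; rewrite ?rmorph0 // msupp0 in_nil.
move=> hc; apply: big_ind => [||k _]; [exact: homog0 | exact: alg_homogD |].
rewrite -[c k]coefK poly_def rmorph_sum mulr_suml.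
apply: big_ind => [||t _]; [exact: homog0 | exact: alg_homogD |].
rewrite -mul_polyC; have [->|nz] := eqVneq (c k)`_t 0.
  by rewrite rmorphM rmorph0 !mul0r.
have -> : d%:Z - e%:Z = 0 + (m * t)%N%:Z + (apery_deg k)%:Z.
  by rewrite (hc k t nz); lia.
rewrite rmorphM base_evalC rmorphXn base_evalX.
apply: alg_homogM; first apply: alg_homogM.
- exact: alg_homog_const.
- elim: (t : nat) => [|t' IH].
    by rewrite muln0 expr0 -(rmorph1 (alg_const m S)); apply: alg_homog_const.
  rewrite exprS mulnS PoszD; apply: alg_homogM => //.
  by have := alg_homog_var ord0; rewrite apery_elt_dvd.
- rewrite /apery_deg /apery_basis; case: eqP => _; last exact: alg_homog_var.
  by rewrite -(rmorph1 (alg_const m S)); apply: alg_homog_const.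
Qed.

End SemigroupAlgebra.

(** * From the tower of syzygies to the resolution *)

Section Augmentation.
Variables (K : fieldType) (m : nat) (S : set nat).

Definition augmentation (v : 'cV[semigroup_algebra K m S]_1) : residue_field K m S :=
  quot_pi (alg_var K S) (v 0 0).

Lemma augmentation_linear : linear augmentation.
Proof.
move=> c x y; rewrite /augmentation !mxE quot_piD.
by congr (_ + _); apply/esym/quot_scale_pi.
Qed.

HB.instance Definition _ := GRing.isLinear.Build (semigroup_algebra K m S)
  'cV[semigroup_algebra K m S]_1 (residue_field K m S)
  _ augmentation augmentation_linear.

Lemma quot_pi0 : quot_pi (@alg_var K m S) 0 = 0 :> residue_field K m S.
Proof. by apply: (addrI (quot_pi (@alg_var K m S) 0)); rewrite -quot_piD !addr0. Qed.

End Augmentation.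

Section TowerResolution.
Variables (K : fieldType) (n : nat) (S : set nat).
Local Notation m := n.+2.
Hypotheses (numS : numerical_semigroup S) (multS : multiplicity S m).
Variables (B : comNzRingType) (C : 'I_m -> 'I_m -> B) (T : Type).
Variables (tau : T -> {rmorphism B -> {poly K}}) (w : T -> 'I_m -> nat).
Variables (eps : {rmorphism B -> K}) (t : T) (e : 'I_m -> 'I_m -> nat).
Hypothesis tau_eps : forall b, (tau t b).[0] = eps b.
Hypothesis wt : forall k, w t k = apery_deg S k.
Hypothesis tauC : forall i j, tau t (C i j) = 'X^(e i j).
Hypothesis apery_degD : forall i j,
  (apery_deg S i + apery_deg S j = apery_deg S (i + j)%R + m * e i j)%N.

Local Notation I := 'I_m.
Variables (s0 : syz I B T 1)
  (next : forall q (s : syz I B T q), syz I B T (s_ngen s)).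
Local Notation valid := (valid C m tau w eps).
Hypothesis s0_valid : valid s0.
Hypothesis nextP : forall q (s : syz I B T q), valid s ->
  valid (next s) /\ forall t, resolves tau t (next s).
Hypothesis s0_deg : forall j, s_deg0 s0 t j = 0%N.
Hypothesis s0_image : forall v : 'rV_(base_rank I 1),
  (v 0 (enum_rank (0, 0))).[0] = 0 <->
  exists c, v = c *m map_mx (tau t) (s_mx s0).

Local Notation st k := (projT2 (tower s0 next k)).
Local Notation A := (semigroup_algebra K m S).
Local Notation col_of := (column (base_eval K n S) (@apery_basis K n S)).

Let d k : 'M[A]_(projT1 (tower s0 next k), projT1 (tower s0 next k.+1)) :=
  boundary (base_eval K n S) (@apery_basis K n S)
    (map_mx (tau t) (s_mx (st k))) (s_gen (st k)).

Let betaM i j : @apery_basis K n S i * apery_basis K S j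
  = base_eval K n S (tau t (C i j)) * apery_basis K S (i + j).
Proof. by rewrite tauC; apply: apery_basisM. Qed.

Lemma tower_boundaryE k v : d k *m col_of v =
  col_of (v *m map_mx (tau t) (s_pres (st k)) *m map_mx (tau t) (s_mx (st k))).
Proof.
have [_ act _ _] := (tower_valid s0_valid nextP k).1 t.
rewrite /s_pres map_gen_mx; apply: (boundary_column betaM) => i.
by rewrite -map_mon_mx; apply: act.
Qed.

(** Exactness at the first free module: an element lies in the maximal ideal
    exactly when it is a boundary. *)
Lemma column_gen_ideal (x : 'cV[A]_1) :
  x 0 0 \in gen_ideal (alg_var K S) <-> exists u, x = d 0 *m u.
Proof.
have [v ->] := column_surj (apery_basis_span apery_degD) x.
rewrite mxE gen_ideal_combination // s0_image.
have [_ [H HP] _ _] := tower_resolves s0_valid nextP t 0.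
split=> [[c vE]|[u]].
  exists (col_of (c *m H)).
  by rewrite tower_boundaryE -(mulmxA c) HP mulmx1 vE.
have [u' ->] := column_surj (apery_basis_span apery_degD) u.
rewrite tower_boundaryE => /eqP; rewrite -subr_eq0 -columnB => /eqP.
move/(column_inj (apery_basis_free numS multS))/eqP; rewrite subr_eq0 => /eqP ->.
by eexists.
Qed.

(** The presentation map of the syzygies is surjective and their inclusion is
    injective, so the kernel of a boundary map is the kernel of the presentation
    map, which is the next module of syzygies. *)
Lemma tower_exact k (x : 'cV[A]_(projT1 (tower s0 next k.+1))) :
  d k *m x = 0 <-> exists u, x = d k.+1 *m u.
Proof.
have [inj _ _ _] := (tower_valid s0_valid nextP k).1 t.
have [_ _ ZP ker] := tower_resolves s0_valid nextP t k.
have [_ [H HP] _ _] := tower_resolves s0_valid nextP t k.+1.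
split=> [|[u ->]]; last first.
  have [u' ->] := column_surj (apery_basis_span apery_degD) u.
  rewrite !tower_boundaryE -!mulmxA (mulmxA (map_mx _ (s_mx _))).
  by rewrite ZP mul0mx !mulmx0 column0.
have [v ->] := column_surj (apery_basis_span apery_degD) x.
rewrite tower_boundaryE => /(column_inj (apery_basis_free numS multS)) /inj /ker[c ->].
exists (col_of (c *m H)).
by rewrite tower_boundaryE -(mulmxA c) HP mulmx1.
Qed.

Lemma tower_resolution : minimal_graded_resolution_of_residue_field d.
Proof.
have hdeg : w t = apery_deg S by apply/funext/wt.
split; last first.
  move=> k i j c c0; rewrite mxE mxE => dE.
  (* A constant entry would have that constant as its coordinate on 1, while the
     coordinates on 1 of the syzygies vanish modulo [y]. *)
  set p := fun l => row (s_gen (st k) j) (map_mx (tau t) (s_mx (st k))) 0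
    (enum_rank (i, l)) in dE.
  have /(apery_basis_free numS multS)/(_ 0) :
      combination (base_eval K n S) (@apery_basis K n S)
        (fun l => p l - (if l == 0 then c%:P else 0)) = 0.
    apply/eqP; rewrite /combination; under eq_bigr do rewrite rmorphB mulrBl.
    rewrite sumrB subr_eq0 -/(combination _ _ p) dE (bigD1 0) //= big1 ?addr0.
      by rewrite base_evalC /apery_basis mulr1.
    by move=> l /negPf ->; rewrite rmorph0 mul0r.
  rewrite eqxx /p !mxE => /(congr1 (fun q : {poly K} => q.[0])) /=.
  rewrite hornerD hornerN hornerC horner0 tau_eps.
  have [_ [min0 _ _]] := tower_valid s0_valid nextP k.
  by rewrite min0 sub0r => /eqP; rewrite oppr_eq0 (negPf c0).
exists (@augmentation K m S), (fun k i => (s_deg0 (st k) t i)%:Z); split.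
- move=> q; exists (const_mx (repr q)).
  by rewrite /= /augmentation mxE; apply: quot_reprK.
- move=> v; rewrite /= /augmentation -quot_pi0 quot_piP subr0.
  exact: column_gen_ideal.
- exact: tower_exact.
- move=> i; rewrite /= s0_deg.
  exists 1; first by rewrite /augmentation mxE !eqxx /= ord1.
  by rewrite -(rmorph1 (alg_const m S)); apply: alg_homog_const.
- move=> k i j.
  have [-> _ _ _] := tower_resolves s0_valid nextP t k.
  have [_ _ hZ _] := (tower_valid s0_valid nextP k).1 t.
  rewrite mxE mxE; apply: alg_homog_combination => // l.
  have := hZ (s_gen (st k) j) (enum_rank (i, l)).
  by rewrite /wdeg enum_rankK hdeg !mxE.
Qed.

End TowerResolution.

(** * The formal symbols *)

Section Symbols.
Variables (K : fieldType) (n : nat).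
Local Notation m := n.+2.
Local Notation B := {mpoly K[#|kunz_symbol m|]}.
Implicit Types (S : set nat) (i j k : 'I_m).

Definition symbol (x : kunz_symbol m) : B := 'X_(enum_rank x).

Definition symbol_y : B := symbol (inl ord0).

(** The symbol [y^(b_ij)], for nonzero [i] and [j]. *)
Definition symbol_b i j : B := symbol (inr (inord i.-1, inord j.-1)).

(** The structure constants of the algebra in the basis
    [1, x_1, ..., x_(m-1)].  When [i + j] is zero, [x_i x_j] is
    [y^(b_ij) x_0], and [x_0] is [y] times the basis element 1. *)
Definition alg_coef i j : B :=
  if (i == 0) || (j == 0) then 1
  else symbol_b i j * (if i + j == 0 then symbol_y else 1).

(** The same constants for the action of the algebra on the basis
    [y, x_1, ..., x_(m-1)] of the maximal ideal. *)
Definition max_coef i j : B :=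
  if j == 0 then 1 else if i == 0 then symbol_y else symbol_b i j.

(** Formal entries of syzygy matrices only involve [y] and the [y^(b_ij)]; the
    other symbols get the value 0 to make this a total ring morphism with values
    in the polynomials in [y]. *)
Definition base_value S (x : kunz_symbol m) : {poly K} :=
  match x with
  | inl i => if i == 0 then 'X else 0
  | inr (i, j) => 'X^(kunz_b S m i.+1 j.+1)
  end.

Definition specialize S : {rmorphism B -> {poly K}} :=
  mmap polyC (fun e => base_value S (enum_val e)).

Definition residue_value S (x : kunz_symbol m) : K :=
  match x with
  | inl i => 0
  | inr (i, j) => (kunz_b S m i.+1 j.+1 == 0%N)%:R
  end.

Definition reduce S : {rmorphism B -> K} :=
  mmap (@idfun K) (fun e => residue_value S (enum_val e)).

(** Setting the symbols [x_i], [i] nonzero, to 0 on the formal side makes the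
    substitution factor through the polynomials in [y] without a restriction on
    the entries, see [formal_subst_drop_x]. *)
Definition drop_x : {rmorphism B -> B} :=
  mmap (@mpolyC _ K)
    (fun e => if enum_val e is inl i then if i == 0 then 'X_e else 0 else 'X_e).

Lemma specialize_symbol S x : specialize S (symbol x) = base_value S x.
Proof. by rewrite /specialize /= mmapX mmap1U enum_rankK. Qed.

Lemma specializeC S c : specialize S c%:MP = c%:P.
Proof. by rewrite /specialize /= mmapC. Qed.

Lemma specialize_y S : specialize S symbol_y = 'X.
Proof. by rewrite specialize_symbol. Qed.

Lemma specialize_b S i j : i != 0 -> j != 0 ->
  specialize S (symbol_b i j) = 'X^(kunz_b S m i j).
Proof.
have predK k : k != 0 -> (inord k.-1 : 'I_n.+1).+1 = k.
  move=> k0; have k_gt0 : (0 < k)%N by rewrite lt0n.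
  by rewrite inordK prednK // -ltnS.
by move=> i0 j0; rewrite specialize_symbol /= !predK.
Qed.

Lemma specialize_reduce S S' :
  (forall i j : 'I_n.+1,
     (kunz_b S m i.+1 j.+1 == 0%N) = (kunz_b S' m i.+1 j.+1 == 0%N)) ->
  forall b, (specialize S b).[0] = reduce S' b.
Proof.
move=> SS' b; rewrite -/(horner_eval 0 (specialize S b)).
apply: (mpoly_rmorph_ext (f := horner_eval 0 \o specialize S)) => [c|e] /=.
  by rewrite !mmapC /horner_eval hornerC.
rewrite !mmapX !mmap1U /horner_eval; case: (enum_val e) => [i|[i j]] /=.
  by case: eqP; rewrite ?hornerX ?horner0.
by rewrite hornerXn expr0n SS'.
Qed.

Definition symbol_basis k : B := if k == 0 then 1 else symbol (inl k).

Definition formal_boundary q r q' (Z : 'M[B]_(r, base_rank 'I_m q)) (g : 'I_q' -> 'I_r) :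
    'M[formal_poly K m]_(q, q') :=
  \matrix_(j, l) \sum_k drop_x (Z (g l) (enum_rank (j, k))) * symbol_basis k.

Section Substitution.
Variables (m_gt1 : (1 < m)%N) (S : set nat).

Lemma formal_subst_symbol x : formal_subst m_gt1 S (symbol x) = symbol_value K m_gt1 S x.
Proof. by rewrite /formal_subst mmapX mmap1U enum_rankK. Qed.

Let y_ord : Ordinal (ltnW m_gt1) = ord0. Proof. exact: val_inj. Qed.

Lemma formal_subst_drop_x b :
  formal_subst m_gt1 S (drop_x b) = base_eval K n S (specialize S b).
Proof.
apply: (mpoly_rmorph_ext (f := formal_subst m_gt1 S \o drop_x)
  (g := base_eval K n S \o specialize S)) => [c|e] /=.
  by rewrite !mmapC -/(base_eval K n S _) base_evalC /formal_subst mmapC.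
rewrite !mmapX !mmap1U -/(base_eval K n S _).
have {2 3}-> : e = enum_rank (enum_val e) by rewrite enum_valK.
case: (enum_val e) => [i|[i j]] /=; last first.
  by rewrite formal_subst_symbol /= y_ord rmorphXn base_evalX.
case: eqP => [->|_]; last by rewrite !rmorph0.
by rewrite formal_subst_symbol base_evalX.
Qed.

Lemma formal_subst_boundary q r q' (Z : 'M[B]_(r, base_rank 'I_m q)) (g : 'I_q' -> 'I_r) :
  map_mx (formal_subst m_gt1 S) (formal_boundary Z g) =
  boundary (base_eval K n S) (@apery_basis K n S) (map_mx (specialize S) Z) g.
Proof.
apply/matrixP=> j l; rewrite !mxE (rmorph_sum (formal_subst m_gt1 S)).
apply: eq_bigr => k _.
rewrite (rmorphM (formal_subst m_gt1 S)) !mxE; congr (_ * _).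
  exact: formal_subst_drop_x.
rewrite /symbol_basis /apery_basis; case: eqP => _; first exact: rmorph1.
exact: formal_subst_symbol.
Qed.

End Substitution.

Section Exponents.
Variable S : set nat.
Hypotheses (numS : numerical_semigroup S) (multS : multiplicity S m).

Definition alg_exp i j : nat :=
  if (i == 0) || (j == 0) then 0%N else (kunz_b S m i j + (i + j == 0)%R)%N.

Lemma specialize_alg_coef i j : specialize S (alg_coef i j) = 'X^(alg_exp i j).
Proof.
rewrite /alg_coef /alg_exp; have [i0|i0] /= := eqVneq i 0; first exact: rmorph1.
have [j0|j0] := eqVneq j 0; first exact: rmorph1.
rewrite rmorphM /= specialize_b // exprD; congr (_ * _).
by case: eqP => _; rewrite ?specialize_y ?rmorph1 ?expr1 ?expr0.
Qed.

Lemma apery_elt_ord i j : apery_elt S m (i + j)%R = apery_elt S m (i + j)%N.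
Proof. by apply: eq_apery_elt; rewrite // modn_mod. Qed.

Lemma apery_deg_alg_exp i j :
  (apery_deg S i + apery_deg S j = apery_deg S (i + j)%R + m * alg_exp i j)%N.
Proof.
rewrite /alg_exp; have [->|i0] /= := eqVneq i 0.
  by rewrite add0r muln0 addn0 {1}/apery_deg eqxx.
have [->|j0] := eqVneq j 0.
  by rewrite addr0 muln0 {2}/apery_deg eqxx.
rewrite /apery_deg (negPf i0) (negPf j0) kunz_bE // -apery_elt_ord.
case: eqP => [->|_]; last by rewrite addn0.
by rewrite apery_elt_dvd // addn1 mulnS.
Qed.

Lemma specialize_max_coef i j : exists2 s,
  specialize S (max_coef i j) = 'X^s &
  ((if i == 0%R then m else apery_deg S i) + apery_deg S j
   = (if (i + j)%R == 0%R then m else apery_deg S (i + j)%R) + m * s)%N.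
Proof.
have deg k : (if k == 0 then m else apery_deg S k) = apery_elt S m k.
  by rewrite /apery_deg; case: eqP => [->|//]; rewrite apery_elt_dvd.
rewrite !deg /max_coef /apery_deg; have [->|j0] := eqVneq j 0.
  by exists 0%N; rewrite ?addr0 ?muln0 // rmorph1.
have [->|i0] := eqVneq i 0.
  exists 1%N; first by rewrite specialize_y expr1.
  by rewrite add0r muln1 [apery_elt S m 0%R]apery_elt_dvd // addnC.
by exists (kunz_b S m i j); rewrite ?specialize_b // apery_elt_ord kunz_bE.
Qed.

End Exponents.
End Symbols.

(** When [i + j] is nonzero modulo [m], [b_ij] vanishes exactly when the
    inequality of index [(i, j)] is tight; otherwise [b_ij] is positive. *)
Lemma kunz_b_face (R : realType) (m : nat) (F : set 'rV[R]_m.-1) (S S' : set nat) :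
  (forall z, F z -> kunz_cone R m z) ->
  numerical_semigroup S -> multiplicity S m ->
  relative_interior F (kunz_point R m S) ->
  numerical_semigroup S' -> multiplicity S' m ->
  F (kunz_point R m S') ->
  forall i j : 'I_m.-1,
    kunz_b S m i.+1 j.+1 = 0%N -> kunz_b S' m i.+1 j.+1 = 0%N.
Proof.
move=> F_sub numS multS rS numS' multS' rS' i j.
have m_gt0 : (0 < m)%N by case: multS.
have im : ~~ (m %| i.+1)%N by rewrite gtnNdvd // -ltn_predRL.
have [dv|ndv] := boolP (m %| i.+1 + j.+1)%N.
  by move=> b0; have := kunz_b_gt0 numS multS im dv; rewrite b0.
have r_gt0 : (0 < (i.+1 + j.+1) %% m)%N by rewrite lt0n.
have lt_l : (((i.+1 + j.+1) %% m).-1 < m.-1)%N.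
  by rewrite -ltnS !prednK // ltn_pmod.
pose l := Ordinal lt_l.
have lE : l.+1 = ((i.+1 + j.+1) %% m)%N by rewrite /= prednK.
have lij : (l.+1 = i.+1 + j.+1 %[mod m])%N by rewrite lE modn_mod.
have pE U : numerical_semigroup U -> multiplicity U m ->
    kunz_b U m i.+1 j.+1 = 0%N <->
    kunz_point R m U 0 l = kunz_point R m U 0 i + kunz_point R m U 0 j.
  move=> numU multU; rewrite !mxE -natrD kunz_bE // -(eq_apery_elt numU multU lij).
  split=> [->|/eqP]; first by rewrite muln0 addn0.
  rewrite eqr_nat -[X in X == _]addn0 eqn_add2l eq_sym muln_eq0.
  by rewrite (gtn_eqF m_gt0) => /eqP.
by move=> /(pE S numS multS) /(relint_tight F_sub lij rS rS') /(pE S' numS' multS').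
Qed.

Theorem corollary3p3 (R : realType) (m : nat) (m_gt1 : (1 < m)%N)
    (K : fieldType) (F : set 'rV[R]_m.-1) (HF : is_face (kunz_cone R m) F) :
  exists (r : nat -> nat) (D : forall n, 'M[formal_poly K m]_(r n, r n.+1)),
    forall S : set nat,
      numerical_semigroup S -> multiplicity S m ->
      relative_interior F (kunz_point R m S) ->
      minimal_graded_resolution_of_residue_field
        (fun n => map_mx (formal_subst m_gt1 S) (D n)).
Proof.
case: m m_gt1 F HF => [|[|n]] // m_gt1 F [c [b [_ FE]]].
have F_sub z : F z -> kunz_cone R n.+2 z by rewrite FE => -[].
pose lies_in S := [/\ numerical_semigroup S, multiplicity S n.+2 &
  relative_interior F (kunz_point R n.+2 S)].
(* The choices in the construction are made with the data of one semigroup of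
   the face; if there is none, any matrices do. *)
have [[S0 S0F]|none] := pselect (exists S, lies_in S); last first.
  by exists (fun=> 0%N), (fun=> 0) => S *; case: none; exists S.
pose T := {S | lies_in S}; pose t0 : T := exist _ S0 S0F.
pose tau (t : T) := specialize K n (sval t); pose w (t : T) := @apery_deg n (sval t).
pose eps := reduce K n S0.
have tau_eps t x : (tau t x).[0] = eps x.
  apply: specialize_reduce => i j; have [nS0 mS0 rS0] := S0F.
  have [nS mS rS] := svalP t.
  by apply/eqP/eqP; apply: (kunz_b_face F_sub) => //; [case: rS0 | case: rS].
have w0 t : w t 0 = 0%N by [].
have w_gt0 t i : i != 0 -> (0 < w t i)%N.
  by case: t => S [nS mS rS]; apply: apery_deg_gt0.
have C0 t k : tau t (alg_coef K k 0) = 1.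
  by rewrite /alg_coef eqxx orbT rmorph1.
have tauC t i j : exists2 s, tau t (alg_coef K i j) = 'X^s &
    (w t i + w t j = w t (i + j)%R + n.+2 * s)%N.
  case: t => S [nS mS rS]; exists (alg_exp S i j); first exact: specialize_alg_coef.
  exact: apery_deg_alg_exp.
have tauE t k i : exists2 s, tau t (max_coef K k i) = 'X^s &
    ((if k == 0%R then n.+2 else w t k) + w t i
     = (if (k + i)%R == 0%R then n.+2 else w t (k + i)%R) + n.+2 * s)%N.
  by case: t => S [nS mS rS]; apply: specialize_max_coef.
have [s0 [s0_valid s0_deg s0_image]] :=
  first_syz (ltn0Sn n.+1) tau_eps w0 tauC t0 (fun t => specialize_y K n (sval t)) tauE.
have [next nextP] := syz_choice (ltn0Sn n.+1) tau_eps
  (fun t => specializeC n (sval t)) w_gt0 C0 tauC t0.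
exists (fun k => projT1 (tower s0 next k)), (fun k =>
  formal_boundary (s_mx (projT2 (tower s0 next k))) (s_gen (projT2 (tower s0 next k)))).
move=> S nS mS rS; pose t : T := exist _ S (And3 nS mS rS).
have -> : (fun k => map_mx (formal_subst m_gt1 S) (formal_boundary
      (s_mx (projT2 (tower s0 next k))) (s_gen (projT2 (tower s0 next k)))))
  = (fun k => boundary (base_eval K n S) (@apery_basis K n S)
      (map_mx (tau t) (s_mx (projT2 (tower s0 next k))))
      (s_gen (projT2 (tower s0 next k)))).
  by apply: functional_extensionality_dep => k; apply: formal_subst_boundary.
apply: (@tower_resolution K n S nS mS _ (@alg_coef K n) T tau w eps t
  (alg_exp S) (tau_eps t) _ _ _ s0 next s0_valid nextP (s0_deg t) (s0_image t)).
- by [].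
- by move=> i j; apply: specialize_alg_coef.
- by move=> i j; apply: apery_deg_alg_exp.
Qed.
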